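(* Let $1 < R < \infty$, let $f$ be analytic inside and on every Bernstein ellipse $\mathcal{E}_\rho$ with $1 \le \rho < R$, and put $\rho_{\max} = R$. Let $$M(\rho) = \frac1\pi \int_0^{2\pi} \left| f\left(\tfrac12\left(\rho e^{i\theta} + (\rho e^{i\theta})^{-1}\right)\right)\right| d\theta, \qquad \vartheta = \sup_{1<\rho<\rho_{\max}}\frac{\rho M'(\rho)}{M(\rho)}.$$ Let $n \ge 0$ be such that the Chebyshev coefficient of the first kind $a_n$ of $f$ is nonzero, and let $\kappa^{\mathrm{Ch1}}(n,\rho)$ be the corresponding condition number. Then: 1. If $n > \vartheta$, then $\kappa^{\mathrm{Ch1}}(n,\rho)$ is strictly decreasing for $1<\rho<\rho_{\max}$. 2. If $\vartheta = \infty$, then $\kappa^{\mathrm{Ch1}}(n,\rho)$ is strictly increasing in the vicinity of $\rho=\rho_{\max}$ (i.e. on some interval $(\rho_0,\rho_{\max})$). 3. If $\vartheta<\infty$ and $\lim_{\rho\to\rho_{\max}}M(\rho)$ exists and is finite, then for $n>\vartheta$ the optimal radius is $\rho=\rho_{\max}$.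
   Context: For $\rho \ge 1$ the Bernstein ellipse is $\mathcal{E}_\rho = \{ z \in \mathbb{C} : z = \frac12(\rho e^{i\theta} + \rho^{-1}e^{-i\theta}),\ 0 \le \theta \le 2\pi\}$ (for $\rho=1$ it degenerates to $[-1,1]$). The Chebyshev coefficients of the first kind of $f$ are $a_n = \frac{2}{\pi}\int_{-1}^1 \frac{f(x)T_n(x)}{\sqrt{1-x^2}}\,dx$, where $T_n(\cos\theta)=\cos(n\theta)$. For $a_n\ne0$ the condition number is $$\kappa^{\mathrm{Ch1}}(n,\rho) = \frac{\int_0^{2\pi}\left|f\left(\frac12(\rho e^{i\theta}+(\rho e^{i\theta})^{-1})\right)\right|d\theta}{\left|\int_0^{2\pi} f\left(\frac12(\rho e^{i\theta}+(\rho e^{i\theta})^{-1})\right)e^{-in\theta}d\theta\right|} = \frac{M(\rho)}{|a_n|\rho^n}, \qquad 1\le\rho<\rho_{\max}.$$ When $\lim_{\rho\to\rho_{\max}}M(\rho)$ exists and is finite, $M$ and $\kappa^{\mathrm{Ch1}}(n,\cdot)$ are extended to $\rho=\rho_{\max}$ by this limit. The optimal radius is the value of $\rho$ minimizing $\kappa^{\mathrm{Ch1}}(n,\rho)$ over the admissible range (over $[1,\rho_{\max}]$ in item 3). The function $M$ is continuously differentiable on $[1,\rho_{\max})$, so $M'$ makes sense. *)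

(* Defs.v *)
From Stdlib Require Import Reals.
From Coquelicot Require Import Coquelicot.
Open Scope R_scope.

(** e^(i theta) *)
Definition cis (theta : R) : C := (cos theta, sin theta).

Definition joukowski (w : C) : C := (RtoC (1 / 2) * (w + / w))%C.

Definition ellipse_point (rho theta : R) : C :=
  joukowski (RtoC rho * cis theta)%C.

Definition bernstein_ellipse (rho : R) (z : C) : Prop :=
  exists theta : R, 0 <= theta <= 2 * PI /\ z = ellipse_point rho theta.

(** The ellipse is convex and centred at 0, so the points inside or on it are
    those lying on a segment from 0 to a point of it; for [rho = 1] this is the
    segment [-1, 1] itself. *)
Definition inside_or_on_ellipse (rho : R) (z : C) : Prop :=
  exists (t : R) (w : C),
    0 <= t <= 1 /\ bernstein_ellipse rho w /\ z = (RtoC t * w)%C.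

Definition analytic_at (f : C -> C) (z0 : C) : Prop :=
  exists (r : R) (c : nat -> C),
    0 < r /\
    forall z : C, Cmod (z - z0)%C < r ->
      is_pseries (K := C_AbsRing) (V := C_NormedModule) c (z - z0)%C (f z).

(** T_n on [-1, 1], from T_n (cos theta) = cos (n theta). *)
Definition chebyshev_T (n : nat) (x : R) : R := cos (INR n * acos x).

(** The integrand is singular at both endpoints, hence the improper integral. *)
Definition cheb1_coeff (f : C -> C) (n : nat) : C :=
  (RtoC (2 / PI) *
   RInt_gen (V := C_R_CompleteNormedModule)
     (fun x : R => (f (RtoC x) * RtoC (chebyshev_T n x / sqrt (1 - x ^ 2)))%C)
     (at_right (-1)) (at_left 1))%C.

Definition mean_M (f : C -> C) (rho : R) : R :=
  1 / PI * RInt (fun theta => Cmod (f (ellipse_point rho theta))) 0 (2 * PI).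

Definition kappa_Ch1 (f : C -> C) (n : nat) (rho : R) : R :=
  RInt (fun theta => Cmod (f (ellipse_point rho theta))) 0 (2 * PI) /
  Cmod (RInt (V := C_R_CompleteNormedModule)
          (fun theta => (f (ellipse_point rho theta) * cis (- (INR n * theta)))%C)
          0 (2 * PI)).

Definition vartheta (f : C -> C) (rho_max : R) : Rbar :=
  Lub_Rbar (fun y : R =>
    exists rho : R, 1 < rho < rho_max /\
      y = rho * Derive (mean_M f) rho / mean_M f rho).

Definition strictly_decreasing_on (g : R -> R) (a b : R) : Prop :=
  forall x y : R, a < x -> x < y -> y < b -> g y < g x.

Definition strictly_increasing_on (g : R -> R) (a b : R) : Prop :=
  forall x y : R, a < x -> x < y -> y < b -> g x < g y.

(** Meaningful only if the limit exists, like [RInt] and [Derive]. *)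
Definition left_limit (g : R -> R) (b : R) : R :=
  iota (fun l : R => filterlim g (at_left b) (locally l)).

Definition extend_by_left_limit (g : R -> R) (b x : R) : R :=
  if Rlt_dec x b then g x else left_limit g b.

(** [r] is the unique minimizer of [g] on [a, b]. *)
Definition is_the_minimizer (g : R -> R) (a b r : R) : Prop :=
  a <= r <= b /\ forall x : R, a <= x <= b -> x <> r -> g r < g x.

(* Main.v *)
(** Put [H z = exp (alpha z) f (cosh z)] with [z = t + i theta]; the ellipse of
    radius [rho = e^t] is the image under [cosh] of the segment of abscissa [t].
    By Taylor's formula of order 2, with a remainder uniform in [theta], the
    average of [H] over [z + r], [z - r], [z + i r], [z - i r] is [H z + O(r^3)].
    Taking moduli and integrating over a period in [theta], where the shifts by
    [i r] disappear, the mean [q t] of [|H|] satisfies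
    [q (t + r) + q (t - r) - 2 q t >= - K r^3], hence obeys the maximum principle.
    As [alpha] is arbitrary, [ln M] is a convex function of [t = ln rho] (Hardy's
    convexity theorem).  For [alpha = - n] the same expansion at order 1 gives
    that the mean of [H] itself is constant in [t], so that
    [kappa rho = pi M rho / (c rho^n)] for a constant [c], nonzero since [a_n] is.
    So [ln kappa] is convex in [t] with slope [rho M' / M - n], and the three
    claims follow by comparing slopes. *)
Require Import Defs.
From Stdlib Require Import Reals Lra Lia Classical ClassicalEpsilon.
From Coquelicot Require Import Coquelicot.
Open Scope R_scope.

(** * Uniform second-order expansions *)

(** The modulus is not differentiable at the zeros of [f], so convexity is read off finite
    differences instead of a Laplacian. The shifts [r, -r, i r, -i r] have zero sum and zero sum of
    squares, which removes the terms of order one and two; the remaining [O(r^3)] is negligible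
    against the gap [2 e r^2] that the maximum principle gains by adding [e (t - a) (t - b)]. The
    exponent [alpha] has to be an arbitrary real because it is the opposite of a chord slope of
    [ln M]. For such an [alpha] the function [H] need not have period [2 PI] in [theta], but [|H|]
    has, and the convexity argument integrates only [|H|]. The constancy of the mean of [H] itself
    rests on [n] being an integer. Since [cosh] is even, [f (cosh z)] is analytic on the two-sided
    strip [- L < t < L] with [L = ln rho_max]. The degenerate ellipse [[-1, 1]], that is [t = 0],
    thus becomes an interior line, and the Chebyshev coefficient can be computed there with the same
    expansions. *)

(** The constants [K] and [d] are explicit so that a family of functions can
    share them. *)
Definition jet2 (K d : R) (g : C -> C) : Prop :=
  exists a b : C, Cmod (g 0%C) <= K /\ Cmod a <= K /\ Cmod b <= K /\
    forall h : C, Cmod h <= d ->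
      Cmod (g h - (g 0 + a * h + b * (h * h)))%C <= K * Cmod h ^ 3.

Lemma jet2_weaken (K d K' d' : R) (g : C -> C) :
  K <= K' -> d' <= d -> jet2 K d g -> jet2 K' d' g.
Proof.
  intros HK Hd (a & b & Hc & Ha & Hb & H).
  exists a, b; repeat split; try lra.
  intros h Hh. apply Rle_trans with (K * Cmod h ^ 3); [apply H; lra|].
  apply Rmult_le_compat_r; [apply pow_le, Cmod_ge_0 | lra].
Qed.

Lemma jet2_ext (K d : R) (g g' : C -> C) :
  (forall h, g h = g' h) -> jet2 K d g -> jet2 K d g'.
Proof.
  intros E (a & b & Hc & Ha & Hb & H).
  exists a, b; rewrite <- E; repeat split; try lra.
  intros h Hh. rewrite <- E. now apply H.
Qed.

Lemma jet2_nonneg (K d : R) (g : C -> C) : jet2 K d g -> 0 <= K.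
Proof.
  intros (a & b & Hc & _). pose proof (Cmod_ge_0 (g 0%C)); lra.
Qed.

Lemma jet2_const (k : C) (d : R) : jet2 (Cmod k) d (fun _ => k).
Proof.
  pose proof (Cmod_ge_0 k). exists 0%C, 0%C.
  rewrite Cmod_0. repeat split; try lra.
  intros h _. replace (k - (k + 0 * h + 0 * (h * h)))%C with (RtoC 0) by ring.
  rewrite Cmod_0. apply Rmult_le_pos; [lra | apply pow_le, Cmod_ge_0].
Qed.

Lemma Cmod_triangle_le (x y : C) (a b : R) :
  Cmod x <= a -> Cmod y <= b -> Cmod (x + y)%C <= a + b.
Proof. intros. pose proof (Cmod_triangle x y); lra. Qed.

Lemma Cmod_mult_le (x y : C) (a b : R) :
  Cmod x <= a -> Cmod y <= b -> Cmod (x * y)%C <= a * b.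
Proof.
  intros. rewrite Cmod_mult.
  apply Rmult_le_compat; auto using Cmod_ge_0.
Qed.

Lemma jet2_plus (K K' d : R) (g g' : C -> C) :
  jet2 K d g -> jet2 K' d g' -> jet2 (K + K') d (fun h => g h + g' h)%C.
Proof.
  intros (a & b & Hc & Ha & Hb & H) (a' & b' & Hc' & Ha' & Hb' & H').
  exists (a + a')%C, (b + b')%C.
  repeat split; try (apply Cmod_triangle_le; assumption).
  intros h Hh.
  replace (g h + g' h - (g 0 + g' 0 + (a + a') * h + (b + b') * (h * h)))%C
    with ((g h - (g 0 + a * h + b * (h * h)))
          + (g' h - (g' 0 + a' * h + b' * (h * h))))%C
    by ring.
  rewrite Rmult_plus_distr_r. apply Cmod_triangle_le; auto.
Qed.

Lemma jet2_cmult (K d : R) (k : C) (g : C -> C) :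
  jet2 K d g -> jet2 (Cmod k * K) d (fun h => k * g h)%C.
Proof.
  intros (a & b & Hc & Ha & Hb & H).
  exists (k * a)%C, (k * b)%C.
  repeat split; try (apply Cmod_mult_le; lra).
  intros h Hh.
  replace (k * g h - (k * g 0 + k * a * h + k * b * (h * h)))%C
    with (k * (g h - (g 0 + a * h + b * (h * h))))%C by ring.
  rewrite Rmult_assoc. apply Cmod_mult_le; [lra | auto].
Qed.

(** The [10] counts terms of order at least 3, surplus powers of [h] being absorbed by [d <= 1]: the
    product of the two quadratics leaves 2 + 1 of them, [E] against the whole second factor 4, and
    [E'] against the first quadratic 3. *)
Lemma jet2_mult (K d : R) (g g' : C -> C) :
  d <= 1 -> jet2 K d g -> jet2 K d g' ->
  jet2 (10 * K * K) d (fun h => g h * g' h)%C.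
Proof.
  intros Hd J J'. pose proof (jet2_nonneg _ _ _ J) as K0.
  destruct J as (a & b & Hc & Ha & Hb & H).
  destruct J' as (a' & b' & Hc' & Ha' & Hb' & H').
  set (c := g 0%C) in *. set (c' := g' 0%C) in *.
  exists (a * c' + c * a')%C, (b * c' + a * a' + c * b')%C.
  assert (KK : 0 <= K * K) by nra.
  repeat split.
  - apply Rle_trans with (K * K); [apply Cmod_mult_le; auto | nra].
  - apply Rle_trans with (K * K + K * K);
      [repeat apply Cmod_triangle_le; apply Cmod_mult_le; auto | nra].
  - apply Rle_trans with (K * K + K * K + K * K);
      [repeat apply Cmod_triangle_le; apply Cmod_mult_le; auto | nra].
  - intros h Hh.
    specialize (H h Hh). specialize (H' h Hh).
    fold c c'.
    set (E := (g h - (c + a * h + b * (h * h)))%C) in *.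
    set (E' := (g' h - (c' + a' * h + b' * (h * h)))%C) in *.
    set (r := Cmod h) in *.
    assert (r0 : 0 <= r) by apply Cmod_ge_0.
    assert (r1 : r <= 1) by lra.
    assert (r2 : 0 <= r * r <= 1) by nra.
    assert (r3 : 0 <= r ^ 3 <= 1) by (simpl; nra).
    replace (g h * g' h - (c * c' + (a * c' + c * a') * h
             + (b * c' + a * a' + c * b') * (h * h)))%C
      with ((a * b' + b * a') * (h * h * h) + b * b' * (h * h * h) * h
            + E * (c' + a' * h + b' * (h * h) + E')
            + (c + a * h + b * (h * h)) * E')%C
      by (unfold E, E'; ring).
    assert (Hh1 : Cmod h <= 1) by (unfold r in *; lra).
    assert (Hh2 : Cmod (h * h)%C <= 1).
    { apply Rle_trans with (1 * 1); [apply Cmod_mult_le; auto | lra]. }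
    assert (Hh3 : Cmod (h * h * h)%C <= r ^ 3).
    { rewrite !Cmod_mult. fold r. right; ring. }
    apply Rle_trans with ((K * K + K * K) * r ^ 3 + K * K * r ^ 3 * 1
      + K * r ^ 3 * (K + K * 1 + K * 1 + K * 1) + (K + K * 1 + K * 1) * (K * r ^ 3)).
    2: right; ring.
    assert (HE' : Cmod E' <= K * 1).
    { apply Rle_trans with (K * r ^ 3); auto. apply Rmult_le_compat_l; lra. }
    apply Cmod_triangle_le; [apply Cmod_triangle_le; [apply Cmod_triangle_le|]|];
    repeat first [assumption | apply Cmod_mult_le | apply Cmod_triangle_le].
Qed.

(** [(1 + Cmod k) ^ 3] dominates 1 and the first three powers of [Cmod k] at once; dividing the
    radius by [1 + Cmod k] keeps [k = 0] admissible. *)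
Lemma jet2_scale (K d : R) (k : C) (g : C -> C) :
  jet2 K d g ->
  jet2 (K * (1 + Cmod k) ^ 3) (d / (1 + Cmod k)) (fun h => g (k * h)%C).
Proof.
  intros J. pose proof (jet2_nonneg _ _ _ J) as K0.
  destruct J as (a & b & Hc & Ha & Hb & H).
  pose proof (Cmod_ge_0 k) as k0. set (s := Cmod k) in *.
  exists (a * k)%C, (b * (k * k))%C.
  rewrite Cmult_0_r.
  assert (s1 : 1 <= (1 + s) ^ 3 /\ s <= (1 + s) ^ 3 /\ s * s <= (1 + s) ^ 3
               /\ s ^ 3 <= (1 + s) ^ 3).
  { assert (0 <= s * s) by nra. assert (0 <= s * s * s) by nra.
    repeat split; simpl; nra. }
  repeat split.
  - nra.
  - apply Rle_trans with (K * s); [apply Cmod_mult_le; unfold s; auto; lra |].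
    apply Rmult_le_compat_l; lra.
  - apply Rle_trans with (K * (s * s));
      [repeat apply Cmod_mult_le; unfold s; auto; lra |].
    apply Rmult_le_compat_l; lra.
  - intros h Hh. pose proof (Cmod_ge_0 h) as h0.
    assert (Hkh : Cmod (k * h)%C <= d).
    { rewrite Cmod_mult. fold s. apply Rmult_le_compat_l with (r := 1 + s) in Hh; [|lra].
      replace ((1 + s) * (d / (1 + s))) with d in Hh by (field; lra). nra. }
    specialize (H _ Hkh). rewrite Cmod_mult in H. fold s in H.
    replace (g (k * h) - (g 0 + a * k * h + b * (k * k) * (h * h)))%C
      with (g (k * h) - (g 0 + a * (k * h) + b * (k * h * (k * h))))%C by ring.
    apply Rle_trans with (1 := H). rewrite Rpow_mult_distr.
    rewrite Rmult_assoc. apply Rmult_le_compat_l; [lra|].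
    apply Rmult_le_compat_r; [apply pow_le; lra | lra].
Qed.

Lemma jet2_increment (K d : R) (g : C -> C) (h : C) :
  d <= 1 -> Cmod h <= d -> jet2 K d g -> Cmod (g h - g 0)%C <= 3 * K * Cmod h.
Proof.
  intros Hd Hh J. pose proof (jet2_nonneg _ _ _ J) as K0.
  destruct J as (a & b & Hc & Ha & Hb & H).
  pose proof (Cmod_ge_0 h) as h0.
  specialize (H h Hh).
  replace (g h - g 0)%C
    with (a * h + b * (h * h) + (g h - (g 0 + a * h + b * (h * h))))%C by ring.
  assert (r2 : 0 <= Cmod h * Cmod h <= Cmod h) by nra.
  assert (r3 : 0 <= Cmod h ^ 3 <= Cmod h) by (simpl; nra).
  apply Rle_trans with (K * Cmod h + K * Cmod h + K * Cmod h); [|lra].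
  repeat apply Cmod_triangle_le.
  - apply Cmod_mult_le; lra.
  - apply Cmod_mult_le; auto. rewrite Cmod_mult; lra.
  - apply Rle_trans with (1 := H). apply Rmult_le_compat_l; lra.
Qed.

(** The increment [k = g h - g 0] is inserted in the quadratic part of [f], where the sum and
    product rules apply; the cubic error transfers because [k] is [O(h)]. [K'] and [d'] are chosen
    before [g] and [f], so that they can serve every [theta]. *)
Lemma jet2_comp (K d K1 d1 : R) :
  0 < d <= 1 -> 0 < d1 ->
  exists K' d', 0 < d' <= 1 /\ forall g f : C -> C, jet2 K d g ->
    jet2 K1 d1 (fun k => f (g 0 + k)%C) -> jet2 K' d' (fun h => f (g h)).
Proof.
  intros Hd Hd1.
  set (L := 3 * K).
  set (Kq := K1 + K1 * (2 * K) + K1 * (10 * (2 * K) * (2 * K))).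
  (* Small enough for [g h - g 0] to stay within [d1]. The absolute value is there because [0 <= K]
     is known only once some [g] has a jet. *)
  set (d' := Rmin d (d1 / (1 + Rabs L))).
  assert (Hd' : d' <= d) by apply Rmin_l.
  exists (Kq + K1 * L ^ 3), d'.
  pose proof (Rabs_pos L) as L0.
  split.
  { split; [|lra]. unfold d'. apply Rmin_case; [lra|].
    apply Rdiv_lt_0_compat; lra. }
  intros g f J F.
  pose proof (jet2_nonneg _ _ _ J) as K0.
  pose proof (jet2_nonneg _ _ _ F) as K10.
  assert (Jk : jet2 (2 * K) d (fun h => g h + - g 0)%C).
  { replace (2 * K) with (K + K) by ring. apply jet2_plus; auto.
    apply jet2_weaken with (Cmod (- g 0%C)) d; try lra.
    - rewrite Cmod_opp. now destruct J as (a & b & Hc & _).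
    - apply jet2_const. }
  pose proof (jet2_mult _ _ _ _ (proj2 Hd) Jk Jk) as Jk2.
  destruct F as (a & b & Hc & Ha & Hb & H). rewrite Cplus_0_r in Hc, H.
  set (c := f (g 0%C)) in *.
  assert (Jq : jet2 Kq d'
    (fun h => c + a * (g h + - g 0) + b * ((g h + - g 0) * (g h + - g 0)))%C).
  { apply jet2_weaken with (2 := Hd')
      (K := (Cmod c + Cmod a * (2 * K)) + Cmod b * (10 * (2 * K) * (2 * K))).
    { assert (0 <= K * K) by nra. pose proof (Cmod_ge_0 a); pose proof (Cmod_ge_0 b).
      unfold Kq; nra. }
    apply jet2_plus; [apply jet2_plus|].
    - apply jet2_const.
    - now apply jet2_cmult.
    - now apply jet2_cmult. }
  destruct Jq as (a2 & b2 & Hc2 & Ha2 & Hb2 & H2).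
  replace (c + a * (g 0 + - g 0) + b * ((g 0 + - g 0) * (g 0 + - g 0)))%C
    with c in Hc2, H2 by ring.
  assert (0 <= K1 * L ^ 3) by (apply Rmult_le_pos; [lra | apply pow_le; unfold L; lra]).
  exists a2, b2; fold c; repeat split; try lra.
  intros h Hh. specialize (H2 h Hh).
  set (k := (g h + - g 0)%C) in *.
  assert (Hk : Cmod k <= L * Cmod h) by (apply jet2_increment with d; auto; lra).
  replace (f (g h) - (c + a2 * h + b2 * (h * h)))%C with
    ((c + a * k + b * (k * k) - (c + a2 * h + b2 * (h * h)))
     + (f (g 0 + k) - (c + a * k + b * (k * k))))%C
    by (replace (g 0 + k)%C with (g h) by (unfold k; ring); ring).
  rewrite Rmult_plus_distr_r. apply Cmod_triangle_le; [lra|].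
  assert (HL : 0 <= L) by (unfold L; lra).
  apply Rle_trans with (K1 * Cmod k ^ 3).
  - apply H. apply Rle_trans with (1 := Hk).
    assert (X : Cmod h <= d1 / (1 + Rabs L)) by (apply Rle_trans with (1 := Hh), Rmin_r).
    rewrite Rabs_pos_eq in X by auto.
    apply Rmult_le_compat_l with (r := 1 + L) in X; [|lra].
    replace ((1 + L) * (d1 / (1 + L))) with d1 in X by (field; lra).
    pose proof (Cmod_ge_0 h); nra.
  - rewrite Rmult_assoc, <- Rpow_mult_distr. apply Rmult_le_compat_l; auto.
    apply pow_incr; split; auto using Cmod_ge_0.
Qed.

(** * Taylor bounds for the complex exponential *)

(** The mean value theorem replaces integration: the factor [1 / (k + 1)] is given up, and each use
    raises the order by one. *)
Lemma antiderivative_pow_bound (g dg : R -> R) (B : R) (k : nat) :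
  0 <= B -> (forall x, is_derive g x (dg x)) -> g 0 = 0 ->
  (forall x, Rabs x <= 1 -> Rabs (dg x) <= B * Rabs x ^ k) ->
  forall x, Rabs x <= 1 -> Rabs (g x) <= B * Rabs x ^ S k.
Proof.
  intros HB Hd H0 H x Hx.
  destruct (MVT_gen g 0 x dg) as (c & Hc & E).
  - intros; apply Hd.
  - intros y _. apply continuity_pt_filterlim.
    apply (ex_derive_continuous g y). now exists (dg y).
  - rewrite H0, !Rminus_0_r in E. rewrite E, Rabs_mult.
    assert (Hcx : Rabs c <= Rabs x).
    { revert Hc. unfold Rmin, Rmax. destruct (Rle_dec 0 x); intros; split_Rabs; lra. }
    simpl. rewrite (Rmult_comm (Rabs x)), <- Rmult_assoc.
    apply Rmult_le_compat_r; [apply Rabs_pos|].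
    apply Rle_trans with (B * Rabs c ^ k); [apply H; lra|].
    apply Rmult_le_compat_l; auto. apply pow_incr; split; auto using Rabs_pos.
Qed.

(** The [3] bounds [exp] on [[-1, 1]] and passes unchanged through each integration. *)
Lemma exp_taylor2 (x : R) : Rabs x <= 1 ->
  Rabs (exp x - 1 - x) <= 3 * Rabs x ^ 2 /\
  Rabs (exp x - 1 - x - x ^ 2 / 2) <= 3 * Rabs x ^ 3.
Proof.
  assert (H1 : forall x, Rabs x <= 1 -> Rabs (exp x - 1) <= 3 * Rabs x ^ 1).
  { apply antiderivative_pow_bound with (dg := exp); [lra| | |].
    - intros y. auto_derive; auto. ring.
    - rewrite exp_0; ring.
    - intros y Hy. rewrite Rabs_pos_eq by (left; apply exp_pos).
      simpl. apply Rle_trans with (exp 1); [|pose proof exp_le_3; lra].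
      destruct (Req_dec y 1) as [->|]; [lra|].
      left; apply exp_increasing. split_Rabs; lra. }
  assert (H2 : forall x, Rabs x <= 1 -> Rabs (exp x - 1 - x) <= 3 * Rabs x ^ 2).
  { apply antiderivative_pow_bound with (dg := fun x => exp x - 1); [lra| | | apply H1].
    - intros y. auto_derive; auto. ring.
    - rewrite exp_0; ring. }
  intros Hx. split; [now apply H2|]. revert x Hx.
  apply antiderivative_pow_bound with (dg := fun x => exp x - 1 - x); [lra| | | apply H2].
  - intros y. auto_derive; auto. field.
  - rewrite exp_0; field.
Qed.

Lemma trig_taylor2 (y : R) : Rabs y <= 1 ->
  Rabs (sin y - y) <= Rabs y ^ 3 /\ Rabs (cos y - 1 + y ^ 2 / 2) <= Rabs y ^ 3.
Proof.
  assert (H1 : forall x, Rabs x <= 1 -> Rabs (sin x) <= 1 * Rabs x ^ 1).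
  { apply antiderivative_pow_bound with (dg := cos); [lra| | |].
    - intros x. auto_derive; auto. ring.
    - apply sin_0.
    - intros x _. simpl. pose proof (COS_bound x). split_Rabs; lra. }
  assert (H2 : forall x, Rabs x <= 1 -> Rabs (cos x - 1) <= 1 * Rabs x ^ 2).
  { apply antiderivative_pow_bound with (dg := fun x => - sin x); [lra| | |].
    - intros x. auto_derive; auto. ring.
    - rewrite cos_0; ring.
    - intros x Hx. rewrite Rabs_Ropp. now apply H1. }
  assert (H3 : forall x, Rabs x <= 1 -> Rabs (sin x - x) <= 1 * Rabs x ^ 3).
  { apply antiderivative_pow_bound with (dg := fun x => cos x - 1); [lra| | |apply H2].
    - intros x. auto_derive; auto. ring.
    - rewrite sin_0; ring. }
  assert (H4 : forall x, Rabs x <= 1 -> Rabs (cos x - 1 + x ^ 2 / 2) <= 1 * Rabs x ^ 4).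
  { apply antiderivative_pow_bound with (dg := fun x => - (sin x - x)); [lra| | |].
    - intros x. auto_derive; auto. field.
    - rewrite cos_0; field.
    - intros x Hx. rewrite Rabs_Ropp. now apply H3. }
  intros Hy. specialize (H3 y Hy). specialize (H4 y Hy).
  split; [lra|]. apply Rle_trans with (1 := H4). rewrite Rmult_1_l.
  pose proof (Rabs_pos y). assert (0 <= Rabs y ^ 3) by (apply pow_le; lra).
  change (Rabs y ^ 4) with (Rabs y * Rabs y ^ 3). nra.
Qed.

Lemma Cmod_le_sum (z : C) : Cmod z <= Rabs (fst z) + Rabs (snd z).
Proof.
  pose proof (Rabs_pos (fst z)); pose proof (Rabs_pos (snd z)).
  unfold Cmod. rewrite <- (sqrt_pow2 (Rabs (fst z) + Rabs (snd z))) by lra.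
  apply sqrt_le_1_alt. rewrite <- (pow2_abs (fst z)), <- (pow2_abs (snd z)). nra.
Qed.

Lemma Rabs_fst_le_Cmod (z : C) : Rabs (fst z) <= Cmod z.
Proof. apply re_le_Cmod. Qed.

Lemma Rabs_snd_le_Cmod (z : C) : Rabs (snd z) <= Cmod z.
Proof.
  unfold Cmod. rewrite <- (sqrt_pow2 (Rabs (snd z))) by apply Rabs_pos.
  apply sqrt_le_1_alt. rewrite pow2_abs. nra.
Qed.

Definition cexp (z : C) : C := (exp (fst z) * cos (snd z), exp (fst z) * sin (snd z)).

Lemma cexp_0 : cexp 0 = 1%C.
Proof.
  unfold cexp; simpl. rewrite exp_0, cos_0, sin_0.
  apply injective_projections; simpl; ring.
Qed.

Lemma cexp_plus (z w : C) : cexp (z + w)%C = (cexp z * cexp w)%C.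
Proof.
  unfold cexp; simpl. rewrite exp_plus, cos_plus, sin_plus.
  apply injective_projections; simpl; ring.
Qed.

Lemma Cmod_cexp (z : C) : Cmod (cexp z) = exp (fst z).
Proof.
  unfold Cmod, cexp; simpl fst; simpl snd.
  replace ((exp (fst z) * cos (snd z)) ^ 2 + (exp (fst z) * sin (snd z)) ^ 2)
    with (exp (fst z) ^ 2).
  - apply sqrt_pow2. left; apply exp_pos.
  - pose proof (sin2_cos2 (snd z)) as E. unfold Rsqr in E.
    transitivity (exp (fst z) ^ 2 * (sin (snd z) * sin (snd z) + cos (snd z) * cos (snd z))).
    rewrite E; ring. ring.
Qed.

Lemma jet2_cexp : jet2 20 1 cexp.
Proof.
  exists 1%C, (RtoC (1 / 2)).
  rewrite cexp_0, Cmod_1, Cmod_R, Rabs_pos_eq by lra.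
  repeat split; try lra.
  intros h Hh.
  pose proof (Rabs_fst_le_Cmod h) as Hx. pose proof (Rabs_snd_le_Cmod h) as Hy.
  set (r := Cmod h) in *.
  set (x := fst h) in *. set (y := snd h) in *.
  destruct (exp_taylor2 x ltac:(lra)) as [E1 E2].
  destruct (trig_taylor2 y ltac:(lra)) as [S1 C1].
  apply Rle_trans with (1 := Cmod_le_sum _).
  pose proof (Rabs_pos x) as x0. pose proof (Rabs_pos y) as y0.
  assert (X2 : Rabs x ^ 2 <= r ^ 2) by (apply pow_incr; lra).
  assert (X3 : Rabs x ^ 3 <= r ^ 3) by (apply pow_incr; lra).
  assert (Y2 : Rabs y ^ 2 <= r ^ 2) by (apply pow_incr; lra).
  assert (Y3 : Rabs y ^ 3 <= r ^ 3) by (apply pow_incr; lra).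
  assert (Px : 0 <= Rabs x ^ 2) by (apply pow_le; lra).
  assert (Py : 0 <= Rabs y ^ 2) by (apply pow_le; lra).
  assert (P3 : 0 <= r ^ 3) by (apply pow_le; lra).
  assert (P2 : 0 <= r ^ 2 <= 1) by (simpl; nra).
  (* The real part is the remainder of [exp] times [cos y], plus the quadratic part of [exp] times
     the remainder of [cos], plus cross terms of order at least 3. In the imaginary part [y]
     supplies one order, so the lower remainder of [exp] suffices. *)
  replace (fst (cexp h - (1 + 1 * h + (1 / 2)%R * (h * h))))%C
    with ((exp x - 1 - x - x ^ 2 / 2) * cos y + (1 + x + x ^ 2 / 2) * (cos y - 1 + y ^ 2 / 2)
          + - (x + x ^ 2 / 2) * (y ^ 2 / 2))
    by (unfold cexp; simpl; fold x y; field).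
  replace (snd (cexp h - (1 + 1 * h + (1 / 2)%R * (h * h))))%C
    with (exp x * (sin y - y) + (exp x - 1 - x) * y)
    by (unfold cexp; simpl; fold x y; field).
  assert (A : forall a b, Rabs (a + b) <= Rabs a + Rabs b) by apply Rabs_triang.
  assert (M : forall a b c d, Rabs a <= c -> Rabs b <= d -> Rabs (a * b) <= c * d).
  { intros. rewrite Rabs_mult. apply Rmult_le_compat; auto using Rabs_pos. }
  assert (T : forall a b c d, Rabs a <= c -> Rabs b <= d -> Rabs (a + b) <= c + d).
  { intros a b c' d' ? ?. pose proof (A a b). lra. }
  assert (Hx2 : Rabs (x ^ 2 / 2) <= r / 2).
  { rewrite Rabs_pos_eq by nra. rewrite <- pow2_abs. nra. }
  assert (Hy2 : Rabs (y ^ 2 / 2) <= r ^ 2 / 2).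
  { rewrite Rabs_pos_eq by nra. rewrite <- pow2_abs. lra. }
  assert (Hex : Rabs (exp x) <= 3).
  { rewrite Rabs_pos_eq by (left; apply exp_pos).
    apply Rle_trans with (exp 1); [|apply exp_le_3].
    destruct (Req_dec x 1) as [->|]; [lra|].
    left; apply exp_increasing. clear - Hx Hh H. split_Rabs; lra. }
  assert (Hcos : Rabs (cos y) <= 1) by (pose proof (COS_bound y); split_Rabs; lra).
  (* For [r <= 1] this is at most [12.25 * r ^ 3]; the [20] is a round number above it. *)
  apply Rle_trans with ((3 * r ^ 3 * 1 + (1 + r + r / 2) * r ^ 3 + (r + r / 2) * (r ^ 2 / 2))
    + (3 * r ^ 3 + 3 * r ^ 2 * r)).
  - apply Rplus_le_compat.
    + apply T; [apply T|].
      * apply M; lra.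
      * apply M; [|lra]. apply T; auto. apply T; auto. rewrite Rabs_R1; lra.
      * apply M; auto. rewrite Rabs_Ropp. apply T; auto.
    + apply T; apply M; lra.
  - assert (r * r ^ 3 <= r ^ 3) by nra. simpl in *. lra.
Qed.

(** * Power series *)

Lemma terms_bounded (v : nat -> C) :
  @ex_series C_AbsRing C_NormedModule v -> exists B, forall m, Cmod (v m) <= B.
Proof.
  intros H. destruct (Cauchy_ex_series (V := C_CompleteNormedModule) v H (mkposreal 1 Rlt_0_1)) as [N HN].
  assert (X : forall N, exists B, forall m, (m < N)%nat -> Cmod (v m) <= B).
  { induction N0 as [|k [B HB]].
    - exists 0; intros; lia.
    - exists (Rmax B (Cmod (v k))). intros m Hm.
      destruct (Nat.eq_dec m k) as [->|]; [apply Rmax_r|].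
      apply Rle_trans with B; [apply HB; lia | apply Rmax_l]. }
  destruct (X N) as [B HB]. exists (Rmax B 1). intros m.
  destruct (Nat.lt_ge_cases m N) as [L|L].
  - apply Rle_trans with B; [now apply HB | apply Rmax_l].
  - apply Rle_trans with 1; [|apply Rmax_r].
    specialize (HN m m L L). rewrite sum_n_n in HN. left. apply HN.
Qed.

Lemma geometric_series_C (v : nat -> C) (B : R) :
  (forall m, Cmod (v m) <= B * (1 / 2) ^ m) ->
  exists l : C, @is_series C_AbsRing C_NormedModule v l /\ Cmod l <= 2 * B.
Proof.
  intros H.
  assert (HB : 0 <= B).
  { specialize (H O). simpl in H. pose proof (Cmod_ge_0 (v O)). lra. }
  assert (G : is_series (fun m => B * (1 / 2) ^ m) (2 * B)).
  { replace (2 * B) with (scal B (/ (1 - 1 / 2))).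
    - apply (is_series_scal B (fun m => (1 / 2) ^ m)). apply is_series_geom.
      rewrite Rabs_pos_eq; lra.
    - unfold scal; simpl; unfold mult; simpl. field. }
  destruct (ex_series_le (V := C_CompleteNormedModule) v _ H (ex_intro _ _ G)) as [l Hl].
  exists l; split; [exact Hl|].
  apply (filterlim_le (F := eventually)
    (fun N => norm (V:=C_NormedModule) (sum_n v N)) (fun N => sum_n (fun m => B * (1 / 2) ^ m) N) (Cmod l) (2 * B)).
  - exists O. intros N _.
    apply Rle_trans with (1 := norm_sum_n_m (V := C_NormedModule) v 0 N).
    apply sum_n_m_le. exact H.
  - apply (filterlim_comp _ _ _ (sum_n v) (norm (V:=C_NormedModule)) _ _ _ Hl).
    apply (filterlim_norm (V := C_NormedModule)).
  - exact G.
Qed.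

(** [(u + k)^m = bin0 m + bin1 m * k + bin2 m * k^2 + bin3 m * k^3]: the first
    three do not depend on [k]. *)
Section BinomialRemainder.
Context (u k : C).

Fixpoint bin0 (m : nat) : C := match m with O => 1%C | S m => (u * bin0 m)%C end.
Fixpoint bin1 (m : nat) : C := match m with O => 0%C | S m => (u * bin1 m + bin0 m)%C end.
Fixpoint bin2 (m : nat) : C := match m with O => 0%C | S m => (u * bin2 m + bin1 m)%C end.
Fixpoint bin3 (m : nat) : C :=
  match m with O => 0%C | S m => ((u + k) * bin3 m + bin2 m)%C end.
End BinomialRemainder.

Lemma pow_bin (u k : C) (m : nat) :
  pow_n (K := C_Ring) (u + k)%C m
  = (bin0 u m + bin1 u m * k + bin2 u m * (k * k) + bin3 u k m * (k * k * k))%C.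
Proof.
  induction m as [|m IH].
  - simpl. change (one : C_Ring) with (RtoC 1). ring.
  - simpl. rewrite IH. change (@mult C_Ring) with Cmult. ring.
Qed.

(** Cauchy estimates without integrals: enlarging the radius from [s] to [s + e] costs one factor
    [/ e] per order, because [s / e^(j+1) + 1 / e^j = (s + e) / e^(j+1)] closes the recurrence. *)
Lemma bin_bound (u k : C) (s e : R) (m : nat) :
  0 < e -> Cmod u <= s -> Cmod (u + k)%C <= s ->
  Cmod (bin0 u m) <= (s + e) ^ m /\ Cmod (bin1 u m) <= / e * (s + e) ^ m /\
  Cmod (bin2 u m) <= / e ^ 2 * (s + e) ^ m /\ Cmod (bin3 u k m) <= / e ^ 3 * (s + e) ^ m.
Proof.
  intros He Hu Huk.
  assert (Hs : 0 <= s) by (pose proof (Cmod_ge_0 u); lra).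
  assert (Ie : 0 < / e) by (now apply Rinv_0_lt_compat).
  assert (Ie2 : 0 < / e ^ 2) by (apply Rinv_0_lt_compat, pow_lt; lra).
  assert (Ie3 : 0 < / e ^ 3) by (apply Rinv_0_lt_compat, pow_lt; lra).
  induction m as [|m (I0 & I1 & I2 & I3)]; simpl bin0; simpl bin1; simpl bin2; simpl bin3.
  - simpl ((s + e) ^ 0). rewrite Cmod_0, Cmod_1. repeat split; lra.
  - assert (P : 0 <= (s + e) ^ m) by (apply pow_le; lra).
    change ((s + e) ^ S m) with ((s + e) * (s + e) ^ m).
    repeat split.
    + apply Rle_trans with (s * (s + e) ^ m); [now apply Cmod_mult_le|]. nra.
    + apply Rle_trans with (s * (/ e * (s + e) ^ m) + (s + e) ^ m).
      * apply Cmod_triangle_le; auto. now apply Cmod_mult_le.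
      * right. field. lra.
    + apply Rle_trans with (s * (/ e ^ 2 * (s + e) ^ m) + / e * (s + e) ^ m).
      * apply Cmod_triangle_le; auto. now apply Cmod_mult_le.
      * right. field. lra.
    + apply Rle_trans with (s * (/ e ^ 3 * (s + e) ^ m) + / e ^ 2 * (s + e) ^ m).
      * apply Cmod_triangle_le; auto. now apply Cmod_mult_le.
      * right. field. lra.
Qed.

(** Re-expansion at a nearby centre [z]: summing [c m] against [bin0], [bin1] and [bin2] gives the
    coefficients at [z], and the series against [bin3] bounds the remainder. The constants depend on
    [z0] alone, as the later compactness argument requires. *)
Lemma analytic_local_jet2 (f : C -> C) (z0 : C) :
  analytic_at f z0 ->
  exists K d, 0 < d /\ forall z : C, Cmod (z - z0)%C <= d -> jet2 K d (fun k => f (z + k)%C).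
Proof.
  intros (r & c & Hr & Hf).
  (* Convergence at distance [r / 2] bounds the coefficients by [B * (2 / r) ^ m]. *)
  destruct (terms_bounded (fun m => pow_n (K := C_Ring) (RtoC (r / 2)) m * c m)%C) as [B HB].
  { exists (f (z0 + RtoC (r / 2))%C).
    specialize (Hf (z0 + RtoC (r / 2))%C).
    replace (z0 + (r / 2)%R - z0)%C with (RtoC (r / 2)) in Hf by ring.
    apply Hf. rewrite Cmod_R, Rabs_pos_eq; lra. }
  assert (Hpow : forall x m, pow_n (K := C_Ring) (RtoC x) m = RtoC (x ^ m)).
  { intros x m. induction m as [|m IH]; [reflexivity|].
    simpl. rewrite IH. change (@mult C_Ring) with Cmult. now rewrite <- RtoC_mult. }
  assert (B0 : 0 <= B) by exact (Rle_trans _ _ _ (Cmod_ge_0 _) (HB O)).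
  assert (Hc : forall m, Cmod (c m) * (r / 4) ^ m <= B * (1 / 2) ^ m).
  { intros m. replace (r / 4) with (r / 2 * (1 / 2)) by field.
    rewrite Rpow_mult_distr, <- Rmult_assoc.
    apply Rmult_le_compat_r; [apply pow_le; lra|].
    specialize (HB m). rewrite Cmod_mult, Hpow, Cmod_R, Rabs_pos_eq in HB by (apply pow_le; lra).
    lra. }
  (* Both [u] and [u + k] have modulus at most [r / 8]; enlarging this radius by [e] gives [r / 4],
     half of [r / 2], whence geometric series of ratio [1 / 2]. *)
  set (e := r / 8).
  assert (He : 0 < e) by (unfold e; lra).
  set (K := 2 * B + 2 * (B * / e) + 2 * (B * / e ^ 2) + 2 * (B * / e ^ 3)).
  assert (Q1 : 0 <= B * / e) by (apply Rmult_le_pos; auto; left; now apply Rinv_0_lt_compat).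
  assert (Q2 : 0 <= B * / e ^ 2) by (apply Rmult_le_pos; auto; left; apply Rinv_0_lt_compat, pow_lt; lra).
  assert (Q3 : 0 <= B * / e ^ 3) by (apply Rmult_le_pos; auto; left; apply Rinv_0_lt_compat, pow_lt; lra).
  exists K, (r / 16). split; [lra|].
  intros z Hz. set (u := (z - z0)%C) in *.
  assert (Hse : r / 4 = e + e) by (unfold e; field).
  assert (Bd : forall k m, Cmod k <= r / 16 ->
    Cmod (bin0 u m) <= (r / 4) ^ m /\ Cmod (bin1 u m) <= / e * (r / 4) ^ m /\
    Cmod (bin2 u m) <= / e ^ 2 * (r / 4) ^ m /\ Cmod (bin3 u k m) <= / e ^ 3 * (r / 4) ^ m).
  { intros k m Hk. rewrite Hse. apply bin_bound; auto.
    - unfold e; lra.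
    - apply Rle_trans with (r / 16 + r / 16); [now apply Cmod_triangle_le | unfold e; lra]. }
  assert (Su : forall (p : nat -> C) A, (forall m, Cmod (p m) <= A * (r / 4) ^ m) ->
    exists l : C, @is_series C_AbsRing C_NormedModule (fun m => c m * p m)%C l
      /\ Cmod l <= 2 * (B * A)).
  { intros p A Hp. apply geometric_series_C. intros m. rewrite Cmod_mult.
    assert (A0 : 0 <= A).
    { specialize (Hp O). simpl in Hp. pose proof (Cmod_ge_0 (p O)). lra. }
    apply Rle_trans with (Cmod (c m) * (A * (r / 4) ^ m)).
    - apply Rmult_le_compat_l; auto using Cmod_ge_0.
    - specialize (Hc m). nra. }
  assert (Z0 : Cmod 0 <= r / 16) by (rewrite Cmod_0; lra).
  destruct (Su (bin0 u) 1) as (l0 & S0 & L0).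
  { intros m. rewrite Rmult_1_l. apply (Bd 0%C m Z0). }
  destruct (Su (bin1 u) (/ e)) as (l1 & S1 & L1); [intros m; apply (Bd 0%C m Z0)|].
  destruct (Su (bin2 u) (/ e ^ 2)) as (l2 & S2 & L2); [intros m; apply (Bd 0%C m Z0)|].
  assert (F : forall k : C, Cmod k <= r / 16 -> exists l3,
    Cmod l3 <= 2 * (B * / e ^ 3) /\
    f (z + k)%C = (l0 + l1 * k + l2 * (k * k) + l3 * (k * k * k))%C).
  { intros k Hk.
    destruct (Su (bin3 u k) (/ e ^ 3)) as (l3 & S3 & L3); [intros m; apply (Bd k m Hk)|].
    exists l3; split; auto.
    (* Both values are sums of the power series at [u + k], the second one regrouped by powers of
       [k]. *)
    apply (filterlim_locally_unique (F := eventually) (V := C_NormedModule)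
      (sum_n (fun m => scal (pow_n (K := C_Ring) (u + k)%C m) (c m)))).
    - replace (u + k)%C with (z + k - z0)%C by (unfold u; ring).
      apply Hf. replace (z + k - z0)%C with (u + k)%C by (unfold u; ring).
      apply Rle_lt_trans with (r / 16 + r / 16); [now apply Cmod_triangle_le | lra].
    - apply (is_series_ext (V := C_NormedModule)
        (fun m => plus (plus (plus (c m * bin0 u m)%C (scal k (c m * bin1 u m)%C))
          (scal (k * k)%C (c m * bin2 u m)%C)) (scal (k * k * k)%C (c m * bin3 u k m)%C))).
      + intros m. rewrite pow_bin.
        unfold scal, plus; simpl; unfold mult, plus; simpl. ring.
      + replace (l0 + l1 * k + l2 * (k * k) + l3 * (k * k * k))%C
          with (plus (plus (plus (l0 : C_NormedModule) (scal k l1)) (scal (k * k)%C l2)) (scal (k * k * k)%C l3))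
          by (unfold scal, plus; simpl; unfold mult, plus; simpl; ring).
        exact (is_series_plus _ _ _ _ (is_series_plus _ _ _ _
          (is_series_plus _ _ _ _ S0 (is_series_scal k _ _ S1))
          (is_series_scal (k * k)%C _ _ S2)) (is_series_scal (k * k * k)%C _ _ S3)). }
  assert (E0 : f (z + 0)%C = l0).
  { destruct (F 0%C Z0) as (l3 & _ & ->). ring. }
  exists l1, l2. rewrite E0. unfold K.
  repeat split; try lra.
  intros k Hk. destruct (F k Hk) as (l3 & L3 & ->).
  replace (l0 + l1 * k + l2 * (k * k) + l3 * (k * k * k) - (l0 + l1 * k + l2 * (k * k)))%C
    with (l3 * (k * k * k))%C by ring.
  apply Cmod_mult_le; [lra|]. rewrite !Cmod_mult. right; ring.
Qed.

(** * The strip *)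

Definition ccosh (z : C) : C := (RtoC (1 / 2) * (cexp z + cexp (- z)))%C.

Lemma ellipse_point_exp (t theta : R) : ellipse_point (exp t) theta = ccosh (t, theta).
Proof.
  unfold ellipse_point, joukowski, ccosh. f_equal.
  assert (E : (RtoC (exp t) * cis theta)%C = cexp (t, theta)).
  { unfold cis, cexp. apply injective_projections; simpl; ring. }
  rewrite E. f_equal.
  assert (N : cexp (t, theta) <> 0%C).
  { intros Z. apply (f_equal Cmod) in Z. rewrite Cmod_cexp, Cmod_0 in Z.
    pose proof (exp_pos t). simpl in Z. lra. }
  transitivity (/ cexp (t, theta) * (cexp (t, theta) * cexp (- (t, theta))))%C;
    [|field; auto].
  rewrite <- cexp_plus.
  replace ((t, theta) + - (t, theta))%C with (RtoC 0) by ring.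
  rewrite cexp_0. ring.
Qed.

(** The addition formula turns the base point into factors [cexp (t, theta)] and
    [cexp (- (t, theta))], whose moduli [exp t] and [exp (- t)] do not depend on [theta]. The radius
    [1 / 2] comes from rescaling by [-1]. *)
Lemma jet2_ccosh (t : R) :
  exists K d, 0 < d <= 1 /\ forall theta, jet2 K d (fun h => ccosh ((t, theta) + h)%C).
Proof.
  exists (/ 2 * (exp t * 20 + exp (- t) * (20 * (1 + 1) ^ 3))), (1 / 2).
  split; [lra|]. intros theta.
  apply jet2_ext with (fun h => RtoC (1 / 2) *
    (cexp (t, theta) * cexp h + cexp (- (t, theta)) * cexp (- (1) * h)))%C.
  - intros h. unfold ccosh. rewrite <- !cexp_plus. do 3 f_equal. ring.
  - replace (/ 2) with (Cmod (RtoC (1 / 2))) by (rewrite Cmod_R, Rabs_pos_eq; lra).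
    apply jet2_cmult, jet2_plus.
    + replace (exp t) with (Cmod (cexp (t, theta))) by (now rewrite Cmod_cexp).
      apply jet2_cmult. apply jet2_weaken with 20 1; try lra. apply jet2_cexp.
    + replace (exp (- t)) with (Cmod (cexp (- (t, theta)))) by (now rewrite Cmod_cexp).
      apply jet2_cmult.
      replace (1 / 2) with (1 / (1 + Cmod (- (1))%C)).
      replace (1 + 1) with (1 + Cmod (- (1))%C).
      apply jet2_scale, jet2_cexp.
      all: rewrite Cmod_opp, Cmod_1; reflexivity || field.
Qed.

(** The margin around [[0, 2 PI]] leaves room for small shifts of [theta]. *)
Definition strip_analytic (f : C -> C) (L : R) : Prop :=
  forall t theta : R, - L < t < L -> -1 <= theta <= 2 * PI + 1 ->
    analytic_at f (ccosh (t, theta)).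

Lemma ccosh_period (t theta : R) : ccosh (t, theta + 2 * PI) = ccosh (t, theta).
Proof.
  rewrite <- !ellipse_point_exp. unfold ellipse_point, cis.
  rewrite cos_plus, sin_plus, cos_2PI, sin_2PI.
  do 3 f_equal; ring.
Qed.

Lemma ccosh_opp (z : C) : ccosh (- z)%C = ccosh z.
Proof. unfold ccosh. replace (- - z)%C with z by ring. ring. Qed.

(** Periodicity supplies the margin in [theta], and evenness of [cosh] the negative [t], so that
    [t = 0] is interior to the strip. *)
Lemma analytic_strip (f : C -> C) (R0 : R) :
  1 < R0 ->
  (forall rho, 1 <= rho < R0 -> forall z, inside_or_on_ellipse rho z -> analytic_at f z) ->
  strip_analytic f (ln R0).
Proof.
  intros HR H.
  pose proof PI2_1 as HPI.
  assert (X : forall t th, 0 <= t < ln R0 -> 0 <= th <= 2 * PI -> analytic_at f (ccosh (t, th))).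
  { intros t th Ht Hth. apply H with (exp t).
    - split.
      + rewrite <- exp_0. destruct (proj1 Ht) as [|<-]; [left; now apply exp_increasing | lra].
      + rewrite <- (exp_ln R0) by lra. now apply exp_increasing.
    - exists 1, (ccosh (t, th)). repeat split; try lra.
      + exists th. rewrite ellipse_point_exp. auto.
      + ring. }
  assert (Y : forall t th, 0 <= t < ln R0 -> -1 <= th <= 2 * PI + 1 -> analytic_at f (ccosh (t, th))).
  { intros t th Ht Hth.
    destruct (Rlt_dec th 0); [|destruct (Rle_dec th (2 * PI))].
    - rewrite <- ccosh_period. apply X; lra.
    - apply X; lra.
    - replace th with ((th - 2 * PI) + 2 * PI) by ring.
      rewrite ccosh_period. apply X; lra. }
  intros t th Ht Hth. destruct (Rle_dec 0 t); [apply Y; lra|].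
  rewrite <- ccosh_opp. change (- (t, th))%C with (- t, - th).
  rewrite <- ccosh_period. apply Y; lra.
Qed.

(** Compactness in [theta]. Taking the constant to be the inverse of the radius lets one gauge
    control both, so that a positive lower bound for the gauge is enough. *)
Lemma strip_jet2 (f : C -> C) (L t : R) :
  strip_analytic f L -> - L < t < L ->
  exists d, 0 < d /\ forall theta, -1 <= theta <= 2 * PI + 1 ->
    jet2 (/ d) d (fun k => f (ccosh (t, theta) + k)%C).
Proof.
  intros HA Ht.
  destruct (jet2_ccosh t) as (Kc & dc & Hdc & Jc).
  assert (Loc : forall theta0, exists e : posreal, -1 <= theta0 <= 2 * PI + 1 ->
    forall theta, Rabs (theta - theta0) < e ->
      jet2 (/ e) e (fun k => f (ccosh (t, theta) + k)%C)).
  { intros theta0.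
    (* The gauge must be defined on the whole line; outside the interval any radius will do. *)
    destruct (Classical_Prop.classic (-1 <= theta0 <= 2 * PI + 1)) as [I|I];
      [|exists (mkposreal 1 Rlt_0_1); tauto].
    destruct (analytic_local_jet2 f _ (HA t theta0 Ht I)) as (K & d & Hd & J).
    pose proof (jet2_nonneg _ _ _ (Jc theta0)) as K0.
    assert (K1 : 0 <= K).
    { apply (jet2_nonneg K d (fun k => f (ccosh (t, theta0) + k)%C)), J.
      replace (ccosh (t, theta0) - ccosh (t, theta0))%C with (RtoC 0) by ring.
      rewrite Cmod_0; lra. }
    (* In turn: the radius of the jet of [f], the validity of the increment bound for [ccosh], a
       displacement of [ccosh] of at most [d], and [K <= / e]. *)
    set (e := Rmin (Rmin d dc) (Rmin (d / (1 + 3 * Kc)) (/ (1 + K)))).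
    assert (P1 : 0 < d / (1 + 3 * Kc)) by (apply Rdiv_lt_0_compat; lra).
    assert (P2 : 0 < / (1 + K)) by (apply Rinv_0_lt_compat; lra).
    assert (He : 0 < e) by (unfold e; repeat apply Rmin_glb_lt; lra).
    assert (e1 : e <= d /\ e <= dc /\ e <= d / (1 + 3 * Kc) /\ e <= / (1 + K)).
    { unfold e. pose proof (Rmin_l (Rmin d dc) (Rmin (d / (1 + 3 * Kc)) (/ (1 + K)))).
      pose proof (Rmin_r (Rmin d dc) (Rmin (d / (1 + 3 * Kc)) (/ (1 + K)))).
      pose proof (Rmin_l d dc). pose proof (Rmin_r d dc).
      pose proof (Rmin_l (d / (1 + 3 * Kc)) (/ (1 + K))).
      pose proof (Rmin_r (d / (1 + 3 * Kc)) (/ (1 + K))). lra. }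
    destruct e1 as (e1 & e2 & e3 & e4).
    exists (mkposreal e He). intros _ theta Hth. simpl in *.
    apply jet2_weaken with K d; auto.
    - apply Rle_trans with (1 + K); [lra|].
      rewrite <- (Rinv_inv (1 + K)). apply Rinv_le_contravar; lra.
    - apply J.
      set (h := (0, theta - theta0) : C).
      assert (Hh : Cmod h = Rabs (theta - theta0)).
      { unfold h, Cmod; simpl. rewrite <- sqrt_Rsqr_abs. unfold Rsqr. f_equal. ring. }
      replace (t, theta) with ((t, theta0) + h)%C
        by (unfold h; apply injective_projections; simpl; ring).
      replace (ccosh (t, theta0)) with (ccosh ((t, theta0) + 0)%C) by (f_equal; ring).
      apply Rle_trans with (3 * Kc * Cmod h).
      + apply jet2_increment with (d := dc) (g := fun h => ccosh ((t, theta0) + h)%C); auto; lra.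
      + rewrite Hh. pose proof (Rabs_pos (theta - theta0)).
        apply Rle_trans with ((1 + 3 * Kc) * (d / (1 + 3 * Kc))); [|right; field; lra].
        apply Rmult_le_compat; lra. }
  set (delta := fun theta0 => proj1_sig (constructive_indefinite_description _ (Loc theta0))).
  assert (Hdelta : forall theta0, -1 <= theta0 <= 2 * PI + 1 ->
    forall theta, Rabs (theta - theta0) < delta theta0 ->
      jet2 (/ delta theta0) (delta theta0) (fun k => f (ccosh (t, theta) + k)%C))
    by exact (fun theta0 => proj2_sig (constructive_indefinite_description _ (Loc theta0))).
  destruct (compactness_value_1d (-1) (2 * PI + 1) delta) as [d Hd].
  exists d. split; [apply cond_pos|].
  (* The compactness lemma provides its covering point only under a double negation. *)
  intros theta Hth. apply NNPP. intros N. apply (Hd theta Hth).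
  intros (th & Hth' & Hc & Hle). apply N.
  apply jet2_weaken with (/ delta th) (delta th); auto.
  apply Rinv_le_contravar; auto. apply cond_pos.
Qed.

(** The function [H] of the overview, [t + i theta] being the pair [(t, theta)]. *)
Definition lift (alpha : R) (f : C -> C) (z : C) : C := (cexp (alpha * z) * f (ccosh z))%C.

Lemma lift_jet2 (f : C -> C) (L alpha t : R) :
  strip_analytic f L -> - L < t < L ->
  exists K d, 0 < d <= 1 /\ forall theta, -1 <= theta <= 2 * PI + 1 ->
    jet2 K d (fun h => lift alpha f ((t, theta) + h)%C).
Proof.
  intros HA Ht.
  destruct (strip_jet2 f L t HA Ht) as (d1 & Hd1 & J1).
  destruct (jet2_ccosh t) as (K & d & Hd & J).
  destruct (jet2_comp K d (/ d1) d1 Hd Hd1) as (K2 & d2 & Hd2 & J2).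
  set (s := 1 + Cmod (RtoC alpha)).
  assert (Hs : 1 <= s) by (unfold s; pose proof (Cmod_ge_0 (RtoC alpha)); lra).
  set (K3 := exp (alpha * t) * (20 * s ^ 3)).
  assert (Hd3 : 0 < / s <= 1).
  { split; [apply Rinv_0_lt_compat; lra|]. rewrite <- Rinv_1. apply Rinv_le_contravar; lra. }
  set (d4 := Rmin d2 (/ s)).
  assert (A : d4 <= d2 /\ d4 <= / s) by (split; [apply Rmin_l | apply Rmin_r]).
  set (K4 := Rmax K2 K3).
  assert (B : K2 <= K4 /\ K3 <= K4) by (split; [apply Rmax_l | apply Rmax_r]).
  exists (10 * K4 * K4), d4. split.
  { split; [unfold d4; apply Rmin_glb_lt; lra | lra]. }
  intros theta Hth. unfold lift. apply jet2_mult; [lra| |].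
  - apply jet2_ext with (fun h => cexp (alpha * (t, theta)) * cexp (alpha * h))%C.
    { intros h. rewrite <- cexp_plus. f_equal. ring. }
    apply jet2_weaken with K3 (/ s); try lra.
    replace K3 with (Cmod (cexp (alpha * (t, theta))) * (20 * s ^ 3)).
    2: { rewrite Cmod_cexp. simpl. unfold K3. do 2 f_equal. ring. }
    apply jet2_cmult. replace (/ s) with (1 / s) by (field; lra).
    apply jet2_scale, jet2_cexp.
  - apply jet2_weaken with K2 d2; try lra.
    apply (J2 (fun h => ccosh ((t, theta) + h)%C)); auto.
    rewrite Cplus_0_r. now apply J1.
Qed.

(** * Means over a period *)

Lemma continuous_of_increment (phi : R -> R) (x d B : R) :
  0 < d -> (forall y, Rabs y <= d -> Rabs (phi (x + y) - phi x) <= B * Rabs y) ->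
  continuous phi x.
Proof.
  intros Hd H. apply continuity_pt_filterlim.
  intros eps He. exists (Rmin d (eps / (1 + Rabs B))).
  pose proof (Rabs_pos B) as B0.
  assert (P : 0 < eps / (1 + Rabs B)) by (apply Rdiv_lt_0_compat; lra).
  split; [apply Rmin_glb_lt; lra|].
  intros y [_ Hy]. simpl in *. unfold R_dist in *.
  assert (H1 : Rabs (y - x) < d) by (apply Rlt_le_trans with (1 := Hy), Rmin_l).
  assert (H2 : Rabs (y - x) < eps / (1 + Rabs B)) by (apply Rlt_le_trans with (1 := Hy), Rmin_r).
  specialize (H (y - x) ltac:(lra)). replace (x + (y - x)) with y in H by ring.
  apply Rle_lt_trans with (1 := H).
  apply Rle_lt_trans with ((1 + Rabs B) * Rabs (y - x)).
  - apply Rmult_le_compat_r; [apply Rabs_pos|]. pose proof (Rle_abs B); lra.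
  - apply Rmult_lt_compat_l with (r := 1 + Rabs B) in H2; [|lra].
    replace ((1 + Rabs B) * (eps / (1 + Rabs B))) with eps in H2 by (field; lra). lra.
Qed.

(** By periodicity the part gained on [[2 PI, 2 PI + y]] equals the part lost on [[0, y]].
    Continuity is asked only on the margin that [strip_analytic] provides. *)
Lemma RInt_periodic_shift (g : R -> R) (y : R) :
  Rabs y <= 1 -> (forall x, g (x + 2 * PI) = g x) ->
  (forall x, -1 <= x <= 2 * PI + 1 -> continuous g x) ->
  is_RInt (fun x => g (x + y)) 0 (2 * PI) (RInt g 0 (2 * PI)).
Proof.
  intros Hy Hp Hc. pose proof PI2_1 as HPI.
  assert (Y : -1 <= y <= 1) by (split_Rabs; lra).
  assert (X : forall a b, -1 <= a <= 2 * PI + 1 -> -1 <= b <= 2 * PI + 1 -> ex_RInt g a b).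
  { intros a b Ha Hb. apply (ex_RInt_continuous (V := R_CompleteNormedModule)).
    intros z Hz. apply Hc. revert Hz. unfold Rmin, Rmax.
    destruct (Rle_dec a b); lra. }
  assert (E : RInt g y (2 * PI + y) = RInt g 0 (2 * PI)).
  { assert (E1 : RInt g (2 * PI) (2 * PI + y) = RInt g 0 y).
    { symmetry. rewrite (RInt_ext g (fun x => scal 1 (g (1 * x + 2 * PI)))).
      - transitivity (RInt g (1 * 0 + 2 * PI) (1 * y + 2 * PI)).
        + apply (RInt_comp_lin g 1 (2 * PI) 0 y). apply X; lra.
        + f_equal; ring.
      - intros x _. replace (1 * x + 2 * PI) with (x + 2 * PI) by ring. rewrite Hp.
        symmetry; apply (scal_one (g x)). }
    rewrite <- (RInt_Chasles g y 0 (2 * PI + y)) by (apply X; lra).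
    rewrite <- (RInt_Chasles g 0 (2 * PI) (2 * PI + y)) by (apply X; lra).
    rewrite E1, <- (opp_RInt_swap g 0 y) by (apply X; lra).
    unfold plus, opp; simpl. ring. }
  rewrite <- E.
  apply (is_RInt_ext (fun x => scal 1 (g (1 * x + y)))).
  - intros x _. replace (1 * x + y) with (x + y) by ring. apply (scal_one (g (x + y))).
  - apply (is_RInt_comp_lin g 1 y 0 (2 * PI)).
    replace (1 * 0 + y) with y by ring. replace (1 * (2 * PI) + y) with (2 * PI + y) by ring.
    apply (RInt_correct g). apply X; lra.
Qed.

(** * Maximum principle and means of [lift] *)

(** If [q] exceeded [Q], adding a small convex parabola that vanishes at [a] and [b] would leave an
    interior maximum; there the second difference of the parabola, [2 * e * r ^ 2], contradicts the
    cubic lower bound. *)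
Lemma three_lines (q : R -> R) (a b Q : R) :
  a < b -> (forall t, a <= t <= b -> continuous q t) -> q a <= Q -> q b <= Q ->
  (forall t, a < t < b -> exists K d, 0 < d /\
    forall r, 0 < r <= d -> - (K * r ^ 3) <= q (t + r) + q (t - r) - 2 * q t) ->
  forall c, a <= c <= b -> q c <= Q.
Proof.
  intros Hab Hc Ha Hb H c Hcab. apply Rnot_lt_le. intros N.
  (* The parabola then lowers [q c] by at most half of its excess over [Q], so the maximum stays
     above [Q] and cannot be at an endpoint. *)
  set (e := (q c - Q) / (2 * (b - a) ^ 2)).
  assert (Hba : 0 < (b - a) ^ 2) by (apply pow_lt; lra).
  assert (He : 0 < e) by (apply Rdiv_lt_0_compat; lra).
  assert (Ee : e * (b - a) ^ 2 = (q c - Q) / 2) by (unfold e; field; lra).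
  destruct (continuity_ab_maj (fun t => q t + e * ((t - a) * (t - b))) a b) as (x & Hx & Hxab).
  - lra.
  - intros t Ht. apply continuity_pt_filterlim.
    apply (continuous_plus q (fun t => e * ((t - a) * (t - b)))); [now apply Hc|].
    apply (ex_derive_continuous (fun t => e * ((t - a) * (t - b)))). auto_derive; auto.
  - assert (M : Q < q x + e * ((x - a) * (x - b))).
    { apply Rlt_le_trans with (2 := Hx c Hcab).
      assert (Z : (c - a) * (b - c) <= (b - a) ^ 2) by nra.
      apply Rmult_le_compat_l with (r := e) in Z; lra. }
    assert (x <> a) by (intros ->; lra).
    assert (x <> b) by (intros ->; lra).
    destruct (H x ltac:(lra)) as (K & d & Hd & HK).
    (* The bound by [e / (1 + Rabs K)] gives [K * r <= e], so the cubic error is at most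
       [e * r ^ 2]; the other bounds keep [x + r] and [x - r] in [[a, b]]. *)
    set (r := Rmin (Rmin d (e / (1 + Rabs K))) (Rmin (x - a) (b - x))).
    pose proof (Rabs_pos K) as K0.
    assert (P : 0 < e / (1 + Rabs K)) by (apply Rdiv_lt_0_compat; lra).
    assert (r0 : 0 < r) by (unfold r; repeat apply Rmin_glb_lt; lra).
    assert (A : r <= d /\ r <= e / (1 + Rabs K) /\ r <= x - a /\ r <= b - x).
    { unfold r. pose proof (Rmin_l (Rmin d (e / (1 + Rabs K))) (Rmin (x - a) (b - x))).
      pose proof (Rmin_r (Rmin d (e / (1 + Rabs K))) (Rmin (x - a) (b - x))).
      pose proof (Rmin_l d (e / (1 + Rabs K))). pose proof (Rmin_r d (e / (1 + Rabs K))).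
      pose proof (Rmin_l (x - a) (b - x)). pose proof (Rmin_r (x - a) (b - x)). lra. }
    destruct A as (A1 & A2 & A3 & A4).
    specialize (HK r ltac:(lra)).
    pose proof (Hx (x + r) ltac:(lra)) as M1. pose proof (Hx (x - r) ltac:(lra)) as M2.
    apply Rmult_le_compat_l with (r := 1 + Rabs K) in A2; [|lra].
    replace ((1 + Rabs K) * (e / (1 + Rabs K))) with e in A2 by (field; lra).
    pose proof (Rle_abs K).
    assert (r2 : 0 < r ^ 2) by (apply pow_lt; lra).
    assert (K * r <= e) by nra.
    assert (K * r ^ 3 <= e * r ^ 2).
    { replace (K * r ^ 3) with (K * r * r ^ 2) by ring. apply Rmult_le_compat_r; lra. }
    nra.
Qed.

Section LiftMeans.
Context (f : C -> C) (L alpha : R) (HA : strip_analytic f L).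

Notation u t theta := (lift alpha f (t%R, theta%R)).

(** Four consequences of one jet: increments along [t] and along [theta], for continuity; a discrete
    Cauchy-Riemann equation, for the constancy of Fourier means; and a discrete submean inequality
    for the modulus, for convexity. *)
Lemma lift_increments (t : R) : - L < t < L ->
  exists B d, 0 < d <= 1 /\ 0 <= B /\
    forall theta, -1 <= theta <= 2 * PI + 1 ->
    (forall x, Rabs x <= d -> Cmod (u (t + x) theta - u t theta)%C <= B * Rabs x) /\
    (forall y, Rabs y <= d -> Cmod (u t (theta + y) - u t theta)%C <= B * Rabs y) /\
    (forall x, Rabs x <= d ->
      Cmod ((u (t + x) theta - u t theta) + Ci * (u t (theta + x)%R - u t theta))%C
        <= B * Rabs x ^ 2) /\
    (forall r, 0 < r <= d ->
      4 * Cmod (u t theta) - B * r ^ 3 <=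
        Cmod (u (t + r) theta) + Cmod (u (t - r) theta) +
        Cmod (u t (theta + r)) + Cmod (u t (theta - r))).
Proof.
  intros Ht. destruct (lift_jet2 f L alpha t HA Ht) as (K & d & Hd & J).
  assert (K0 : 0 <= K).
  { apply jet2_nonneg with (1 := J 0 ltac:(pose proof PI2_1; lra)). }
  exists (4 * K), d. split; [lra|]. split; [lra|]. intros theta Hth. specialize (J theta Hth).
  assert (Mx : forall x, Cmod ((x, 0) : C) = Rabs x).
  { intros x. apply Cmod_R. }
  assert (My : forall x, Cmod ((0, x) : C) = Rabs x).
  { intros x. unfold Cmod; simpl. rewrite <- sqrt_Rsqr_abs. unfold Rsqr. f_equal; ring. }
  assert (Ex : forall x, ((t, theta) + (x, 0))%C = (t + x, theta))
    by (intros; apply injective_projections; simpl; ring).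
  assert (Ey : forall x, ((t, theta) + (0, x))%C = (t, theta + x))
    by (intros; apply injective_projections; simpl; ring).
  assert (E0 : ((t, theta) + 0)%C = (t, theta)) by ring.
  assert (I : forall h, Cmod h <= d ->
    Cmod (lift alpha f ((t, theta) + h)%C - u t theta)%C <= 4 * K * Cmod h).
  { intros h Hh.
    pose proof (jet2_increment K d _ h (proj2 Hd) Hh J) as X. cbv beta in X.
    rewrite E0 in X. pose proof (Cmod_ge_0 h). nra. }
  destruct J as (a & b & _ & _ & Hb & J). rewrite E0 in J.
  split; [|split; [|split]].
  - intros x Hx. rewrite <- Ex, <- (Mx x). apply I. now rewrite Mx.
  - intros x Hx. rewrite <- Ey, <- (My x). apply I. now rewrite My.
  - intros x Hx.
    pose proof (J (x, 0) ltac:(now rewrite Mx)) as J1. rewrite Mx, Ex in J1.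
    pose proof (J (0, x) ltac:(now rewrite My)) as J2. rewrite My, Ey in J2.
    (* As [(0, x) = Ci * (x, 0)] and [Ci * Ci = -1], the linear terms cancel and the quadratic ones
       leave [(1 - Ci) * b]. *)
    replace (u (t + x) theta - u t theta + Ci * (u t (theta + x)%R - u t theta))%C
      with ((1 - Ci) * b * ((x, 0) * (x, 0)) +
        (u (t + x) theta - (u t theta + a * (x, 0) + b * ((x, 0) * (x, 0))))
        + Ci * (u t (theta + x)%R - (u t theta + a * (0, x) + b * ((0, x) * (0, x)))))%C.
    2: { replace ((0, x) : C) with (Ci * (x, 0))%C
           by (apply injective_projections; simpl; ring).
         replace (Ci * (u t (theta + x)%R
             - (u t theta + a * (Ci * (x, 0)) + b * (Ci * (x, 0) * (Ci * (x, 0))))))%C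
           with (Ci * (u t (theta + x)%R - u t theta) - (Ci * Ci) * a * (x, 0)
             - (Ci * Ci) * Ci * b * ((x, 0) * (x, 0)))%C by ring.
         replace (Ci * Ci)%C with (- (1))%C by (apply injective_projections; simpl; ring).
         ring. }
    pose proof (Rabs_pos x).
    assert (X3 : Rabs x ^ 3 <= Rabs x ^ 2).
    { change (Rabs x ^ 3) with (Rabs x * Rabs x ^ 2).
      pose proof (pow_le (Rabs x) 2). nra. }
    assert (Ci1 : Cmod Ci = 1).
    { change Ci with ((0, 1) : C). rewrite My. apply Rabs_R1. }
    apply Rle_trans with ((1 + 1) * K * (Rabs x * Rabs x) + K * Rabs x ^ 3 + 1 * (K * Rabs x ^ 3)).
    + apply Cmod_triangle_le; [apply Cmod_triangle_le; [|exact J1]|].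
      * apply Cmod_mult_le; [apply Cmod_mult_le; auto|].
        -- apply Cmod_triangle_le; [rewrite Cmod_1|rewrite Cmod_opp]; lra.
        -- apply Cmod_mult_le; rewrite Mx; lra.
      * apply Cmod_mult_le; [lra | exact J2].
    + simpl in *. nra.
  - intros r Hr.
    assert (Ar : Rabs r = r) by (apply Rabs_pos_eq; lra).
    assert (Ar' : Rabs (- r) = r) by (rewrite Rabs_Ropp; lra).
    pose proof (J (r, 0) ltac:(rewrite Mx; lra)) as J1. rewrite Mx, Ex, Ar in J1.
    pose proof (J (- r, 0) ltac:(rewrite Mx; lra)) as J2. rewrite Mx, Ex, Ar' in J2.
    pose proof (J (0, r) ltac:(rewrite My; lra)) as J3. rewrite My, Ey, Ar in J3.
    pose proof (J (0, - r) ltac:(rewrite My; lra)) as J4. rewrite My, Ey, Ar' in J4.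
    set (g1 := u (t + r) theta) in *. set (g2 := u (t + - r) theta) in *.
    set (g3 := u t (theta + r)) in *. set (g4 := u t (theta + - r)) in *.
    change (t - r) with (t + - r). change (theta - r) with (theta + - r).
    fold g2 g4. set (g0 := u t theta) in *.
    (* The four shifts and their squares both sum to zero, so only the four remainders survive. *)
    assert (X : Cmod (4 * g0 + - g1 + - g2 + - g3 + - g4)%C <= 4 * K * r ^ 3).
    { replace (4 * g0 + - g1 + - g2 + - g3 + - g4)%C with
        (- (g1 - (g0 + a * (r, 0) + b * ((r, 0) * (r, 0))))
         + - (g2 - (g0 + a * ((- r)%R, 0) + b * (((- r)%R, 0) * ((- r)%R, 0))))
         + - (g3 - (g0 + a * (0, r) + b * ((0, r) * (0, r))))
         + - (g4 - (g0 + a * (0, (- r)%R) + b * ((0, (- r)%R) * (0, (- r)%R)))))%C.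
      2: { apply injective_projections; simpl; ring. }
      replace (4 * K * r ^ 3) with (K * r ^ 3 + K * r ^ 3 + K * r ^ 3 + K * r ^ 3) by ring.
      repeat apply Cmod_triangle_le; rewrite Cmod_opp; assumption. }
    assert (Y : Cmod (4 * g0)%C <= 4 * K * r ^ 3 + Cmod g1 + Cmod g2 + Cmod g3 + Cmod g4).
    { replace (4 * g0)%C with ((4 * g0 + - g1 + - g2 + - g3 + - g4) + g1 + g2 + g3 + g4)%C by ring.
      repeat apply Cmod_triangle_le; lra. }
    rewrite Cmod_mult, Cmod_R, Rabs_pos_eq in Y by lra. lra.
Qed.

(** A Lipschitz functional covers the modulus, the real part and the imaginary part in one
    argument. *)
Context (p : C -> R) (Hp : forall z w : C, Rabs (p z - p w) <= Cmod (z - w)%C).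

Lemma lift_continuous (t theta : R) : - L < t < L -> -1 <= theta <= 2 * PI + 1 ->
  continuous (fun x => p (u t x)) theta.
Proof.
  intros Ht Hth. destruct (lift_increments t Ht) as (B & d & Hd & HB & H).
  apply continuous_of_increment with d B; [lra|].
  intros y Hy. apply Rle_trans with (1 := Hp _ _). now apply H.
Qed.

Lemma lift_ex_RInt (t : R) : - L < t < L -> ex_RInt (fun x => p (u t x)) 0 (2 * PI).
Proof.
  intros Ht. pose proof PI2_1.
  apply (ex_RInt_continuous (V := R_CompleteNormedModule)). intros x.
  rewrite Rmin_left, Rmax_right by lra.
  intros Hx. apply lift_continuous; lra.
Qed.

Lemma lift_mean_continuous (t : R) : - L < t < L ->
  continuous (fun t => RInt (fun x => p (u t x)) 0 (2 * PI)) t.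
Proof.
  intros Ht. destruct (lift_increments t Ht) as (B & d & Hd & HB & H).
  pose proof PI2_1 as HPI.
  apply continuous_of_increment with (Rmin d (Rmin (t + L) (L - t) / 2)) (2 * PI * B).
  { assert (0 < Rmin (t + L) (L - t)) by (apply Rmin_glb_lt; lra). apply Rmin_glb_lt; lra. }
  intros x Hx.
  assert (X1 : Rabs x <= d) by (apply Rle_trans with (1 := Hx), Rmin_l).
  assert (X2 : Rabs x <= Rmin (t + L) (L - t) / 2) by (apply Rle_trans with (1 := Hx), Rmin_r).
  pose proof (Rmin_l (t + L) (L - t)). pose proof (Rmin_r (t + L) (L - t)).
  assert (Htx : - L < t + x < L) by (split_Rabs; lra).
  apply Rle_trans with ((2 * PI - 0) * (B * Rabs x)); [|right; ring].
  rewrite <- (RInt_minus (V := R_CompleteNormedModule)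
    (fun y => p (u (t + x) y)) (fun y => p (u t y))) by now apply lift_ex_RInt.
  apply abs_RInt_le_const; [lra| |].
  - apply (ex_RInt_minus (V := R_NormedModule)); now apply lift_ex_RInt.
  - intros y Hy. apply Rle_trans with (1 := Hp _ _). apply H; lra.
Qed.
End LiftMeans.

Lemma Cmod_lipschitz (z w : C) : Rabs (Cmod z - Cmod w) <= Cmod (z - w)%C.
Proof.
  pose proof (Cmod_triangle (z - w) w) as X. pose proof (Cmod_triangle (w - z) z) as Y.
  replace (z - w + w)%C with z in X by ring. replace (w - z + z)%C with w in Y by ring.
  replace (w - z)%C with (- (z - w))%C in Y by ring. rewrite Cmod_opp in Y.
  split_Rabs; lra.
Qed.

Lemma fst_lipschitz (z w : C) : Rabs (fst z - fst w) <= Cmod (z - w)%C.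
Proof. exact (Rabs_fst_le_Cmod (z - w)%C). Qed.

Lemma snd_lipschitz (z w : C) : Rabs (snd z - snd w) <= Cmod (z - w)%C.
Proof. exact (Rabs_snd_le_Cmod (z - w)%C). Qed.

Lemma Cmod_lift (alpha : R) (f : C -> C) (t theta : R) :
  Cmod (lift alpha f (t, theta)) = exp (alpha * t) * Cmod (f (ccosh (t, theta))).
Proof.
  unfold lift. rewrite Cmod_mult, Cmod_cexp. simpl. do 2 f_equal. ring.
Qed.

(** Not normalized: this is [PI * mean_M f (exp t)]. *)
Definition abs_mean (f : C -> C) (t : R) : R :=
  RInt (fun theta => Cmod (f (ccosh (t, theta)))) 0 (2 * PI).

Lemma abs_ex_RInt (f : C -> C) (L t : R) : strip_analytic f L -> - L < t < L ->
  ex_RInt (fun theta => Cmod (f (ccosh (t, theta)))) 0 (2 * PI).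
Proof.
  intros HA Ht. apply ex_RInt_ext with (fun theta => Cmod (lift 0 f (t, theta))).
  - intros x _. rewrite Cmod_lift, Rmult_0_l, exp_0. apply Rmult_1_l.
  - apply lift_ex_RInt with L; auto. apply Cmod_lipschitz.
Qed.

Lemma RInt_Cmod_lift (f : C -> C) (L alpha t : R) : strip_analytic f L -> - L < t < L ->
  RInt (fun theta => Cmod (lift alpha f (t, theta))) 0 (2 * PI)
  = exp (alpha * t) * abs_mean f t.
Proof.
  intros HA Ht. unfold abs_mean.
  rewrite <- (RInt_scal (V := R_CompleteNormedModule)
    (fun theta => Cmod (f (ccosh (t, theta))))) by now apply abs_ex_RInt with L.
  apply RInt_ext. intros x _. apply Cmod_lift.
Qed.

(** Integrating the submean inequality, the two shifts in [theta] each reproduce the mean at [t], so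
    that [4 q t] becomes [2 q t] and the hypothesis of [three_lines] remains. *)
Lemma abs_mean_three_lines (f : C -> C) (L alpha a b Q : R) :
  strip_analytic f L -> - L < a -> a < b -> b < L ->
  exp (alpha * a) * abs_mean f a <= Q -> exp (alpha * b) * abs_mean f b <= Q ->
  forall c, a <= c <= b -> exp (alpha * c) * abs_mean f c <= Q.
Proof.
  intros HA Ha Hab Hb Qa Qb c Hc. pose proof PI2_1 as HPI.
  rewrite <- (RInt_Cmod_lift f L) in * by (auto; lra).
  revert c Hc.
  apply three_lines; auto.
  - intros t Ht. apply lift_mean_continuous with L; auto using Cmod_lipschitz. lra.
  - intros t Ht.
    destruct (lift_increments f L alpha HA t ltac:(lra)) as (B & d & Hd & HB & H).
    exists (2 * PI * B), (Rmin d (Rmin (t - a) (b - t))).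
    split; [repeat apply Rmin_glb_lt; lra|].
    intros r Hr.
    pose proof (Rmin_l d (Rmin (t - a) (b - t))). pose proof (Rmin_r d (Rmin (t - a) (b - t))).
    pose proof (Rmin_l (t - a) (b - t)). pose proof (Rmin_r (t - a) (b - t)).
    set (g := fun t theta => Cmod (lift alpha f (t, theta))).
    fold (g (t + r)) (g (t - r)) (g t).
    assert (G : forall s, a <= s <= b -> is_RInt (g s) 0 (2 * PI) (RInt (g s) 0 (2 * PI))).
    { intros s Hs. apply (RInt_correct (g s)). apply lift_ex_RInt with L; auto using Cmod_lipschitz. lra. }
    assert (S : forall y, Rabs y <= 1 ->
      is_RInt (fun x => g t (x + y)) 0 (2 * PI) (RInt (g t) 0 (2 * PI))).
    { intros y Hy. apply RInt_periodic_shift; auto.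
      - intros x. unfold g. rewrite !Cmod_lift. now rewrite ccosh_period.
      - intros x Hx. apply lift_continuous with L; auto using Cmod_lipschitz. lra. }
    pose proof (is_RInt_plus _ _ _ _ _ _ (is_RInt_plus _ _ _ _ _ _ (is_RInt_plus _ _ _ _ _ _
      (G (t + r) ltac:(lra)) (G (t - r) ltac:(lra)))
      (S r ltac:(rewrite Rabs_pos_eq; lra)))
      (S (- r) ltac:(rewrite Rabs_Ropp, Rabs_pos_eq; lra))) as U.
    pose proof (is_RInt_minus _ _ _ _ _ _ (is_RInt_scal _ _ _ 4 _ (G t ltac:(lra)))
      (is_RInt_const 0 (2 * PI) (B * r ^ 3))) as V.
    assert (X := is_RInt_le _ _ 0 (2 * PI) _ _ ltac:(lra) V U).
    unfold minus, plus, opp, scal in X; simpl in X. unfold mult in X; simpl in X.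
    assert (Y : 4 * RInt (g t) 0 (2 * PI) + - ((2 * PI - 0) * (B * r ^ 3)) <=
      RInt (g (t + r)) 0 (2 * PI) + RInt (g (t - r)) 0 (2 * PI) + RInt (g t) 0 (2 * PI)
       + RInt (g t) 0 (2 * PI)).
    { apply X. intros x Hx. apply (H x); lra. }
    lra.
Qed.

(** Here the integrality of [n] enters: the factor [exp (- i n theta)] has period [2 PI]. *)
Lemma lift_period (f : C -> C) (n : nat) (t theta : R) :
  lift (- INR n) f (t, theta + 2 * PI) = lift (- INR n) f (t, theta).
Proof.
  unfold lift. rewrite ccosh_period. f_equal.
  unfold cexp; simpl.
  replace (- INR n * (theta + 2 * PI) + 0 * t) with (- (INR n * theta + 2 * INR n * PI)) by ring.
  replace (- INR n * theta + 0 * t) with (- (INR n * theta)) by ring.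
  rewrite !cos_neg, !sin_neg, cos_period, sin_period.
  do 3 f_equal; ring.
Qed.

Lemma is_derive_0_quadratic (g : R -> R) (x d B : R) :
  0 < d -> (forall y, Rabs y <= d -> Rabs (g (x + y) - g x) <= B * Rabs y ^ 2) ->
  is_derive g x 0.
Proof.
  intros Hd H. apply is_derive_Reals. intros e He.
  pose proof (Rabs_pos B) as B0.
  assert (P : 0 < e / (1 + Rabs B)) by (apply Rdiv_lt_0_compat; lra).
  assert (Q : 0 < Rmin d (e / (1 + Rabs B))) by (apply Rmin_glb_lt; lra).
  exists (mkposreal _ Q). simpl. intros h Hh0 Hh.
  pose proof (Rmin_l d (e / (1 + Rabs B))). pose proof (Rmin_r d (e / (1 + Rabs B))).
  assert (Hp : 0 < Rabs h) by now apply Rabs_pos_lt.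
  specialize (H h ltac:(lra)).
  rewrite Rminus_0_r. unfold Rdiv. rewrite Rabs_mult, Rabs_inv by auto.
  apply Rle_lt_trans with (Rabs B * Rabs h).
  - apply Rmult_le_reg_r with (Rabs h); auto. rewrite Rmult_assoc, Rinv_l by lra.
    pose proof (Rle_abs B). simpl in H. nra.
  - assert (Y : Rabs h < e / (1 + Rabs B)) by lra.
    apply Rmult_lt_compat_l with (r := 1 + Rabs B) in Y; [|lra].
    replace ((1 + Rabs B) * (e / (1 + Rabs B))) with e in Y by (field; lra). nra.
Qed.

(** Integrating the discrete Cauchy-Riemann equation, the increment along [theta] disappears by
    periodicity; the increment of the mean along [t] is therefore quadratic and its derivative
    zero. *)
Lemma fourier_means_constant (f : C -> C) (L t : R) (n : nat) :
  strip_analytic f L -> 0 <= t < L ->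
  RInt (fun theta => fst (lift (- INR n) f (t, theta))) 0 (2 * PI)
  = RInt (fun theta => fst (lift (- INR n) f (0, theta))) 0 (2 * PI) /\
  RInt (fun theta => snd (lift (- INR n) f (t, theta))) 0 (2 * PI)
  = RInt (fun theta => snd (lift (- INR n) f (0, theta))) 0 (2 * PI).
Proof.
  intros HA Ht. destruct (proj1 Ht) as [Ht0|<-]; [|auto].
  pose proof PI2_1 as HPI.
  set (g := fun s theta => fst (lift (- INR n) f (s, theta))).
  set (k := fun s theta => snd (lift (- INR n) f (s, theta))).
  assert (Gi : forall s, - L < s < L -> is_RInt (g s) 0 (2 * PI) (RInt (g s) 0 (2 * PI))).
  { intros s Hs. apply (RInt_correct (g s)). apply lift_ex_RInt with L; auto using fst_lipschitz. }
  assert (Ki : forall s, - L < s < L -> is_RInt (k s) 0 (2 * PI) (RInt (k s) 0 (2 * PI))).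
  { intros s Hs. apply (RInt_correct (k s)). apply lift_ex_RInt with L; auto using snd_lipschitz. }
  assert (Gs : forall s y, - L < s < L -> Rabs y <= 1 ->
    is_RInt (fun x => g s (x + y)) 0 (2 * PI) (RInt (g s) 0 (2 * PI))).
  { intros s y Hs Hy. apply RInt_periodic_shift; auto.
    - intros x. unfold g. now rewrite lift_period.
    - intros x Hx. apply lift_continuous with L; auto using fst_lipschitz. }
  assert (Ks : forall s y, - L < s < L -> Rabs y <= 1 ->
    is_RInt (fun x => k s (x + y)) 0 (2 * PI) (RInt (k s) 0 (2 * PI))).
  { intros s y Hs Hy. apply RInt_periodic_shift; auto.
    - intros x. unfold k. now rewrite lift_period.
    - intros x Hx. apply lift_continuous with L; auto using snd_lipschitz. }
  assert (D : forall s, 0 <= s <= t ->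
    is_derive (fun s => RInt (g s) 0 (2 * PI)) s 0 /\
    is_derive (fun s => RInt (k s) 0 (2 * PI)) s 0).
  { intros s Hs.
    destruct (lift_increments f L (- INR n) HA s ltac:(lra)) as (B & d & Hd & HB & H).
    set (d' := Rmin d ((L - t) / 2)).
    assert (Hd' : 0 < d') by (apply Rmin_glb_lt; lra).
    pose proof (Rmin_l d ((L - t) / 2)) as d1. pose proof (Rmin_r d ((L - t) / 2)) as d2. fold d' in d1, d2.
    split; apply is_derive_0_quadratic with d' (2 * PI * B); auto; intros y Hy.
    - assert (Hsy : - L < s + y < L) by (split_Rabs; lra).
      (* The real part of [Ci * w] is minus the imaginary part of [w]: the real mean is paired with
         a shift of the imaginary part, and conversely below. *)
      pose proof (is_RInt_minus _ _ _ _ _ _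
        (is_RInt_minus _ _ _ _ _ _ (Gi (s + y) Hsy) (Gi s ltac:(lra)))
        (is_RInt_minus _ _ _ _ _ _ (Ks s y ltac:(lra) ltac:(lra)) (Ki s ltac:(lra)))) as X.
      apply norm_RInt_le_const with (M := B * Rabs y ^ 2) in X; [|lra|].
      + unfold minus, plus, opp, norm, abs in X; simpl in X. unfold abs in X; simpl in X.
        replace (2 * PI * B * Rabs y ^ 2) with ((2 * PI - 0) * (B * Rabs y ^ 2)) by ring.
        apply Rle_trans with (2 := X). right. f_equal. ring.
      + intros x Hx. destruct (H x ltac:(lra)) as (_ & _ & Hcr & _).
        apply Rle_trans with (2 := Hcr y ltac:(lra)).
        apply Rle_trans with (2 := Rabs_fst_le_Cmod _).
        right. unfold minus, plus, opp, norm, abs, g, k; simpl. unfold abs; simpl. f_equal. ring.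
    - assert (Hsy : - L < s + y < L) by (split_Rabs; lra).
      pose proof (is_RInt_plus _ _ _ _ _ _
        (is_RInt_minus _ _ _ _ _ _ (Ki (s + y) Hsy) (Ki s ltac:(lra)))
        (is_RInt_minus _ _ _ _ _ _ (Gs s y ltac:(lra) ltac:(lra)) (Gi s ltac:(lra)))) as X.
      apply norm_RInt_le_const with (M := B * Rabs y ^ 2) in X; [|lra|].
      + unfold minus, plus, opp, norm, abs in X; simpl in X. unfold abs in X; simpl in X.
        replace (2 * PI * B * Rabs y ^ 2) with ((2 * PI - 0) * (B * Rabs y ^ 2)) by ring.
        apply Rle_trans with (2 := X). right. f_equal. ring.
      + intros x Hx. destruct (H x ltac:(lra)) as (_ & _ & Hcr & _).
        apply Rle_trans with (2 := Hcr y ltac:(lra)).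
        apply Rle_trans with (2 := Rabs_snd_le_Cmod _).
        right. unfold minus, plus, opp, norm, abs, g, k; simpl. unfold abs; simpl. f_equal. ring. }
  split; symmetry.
  - apply (eq_is_derive (fun s => RInt (g s) 0 (2 * PI)) 0 t); auto. intros s Hs. now apply D.
  - apply (eq_is_derive (fun s => RInt (k s) 0 (2 * PI)) 0 t); auto. intros s Hs. now apply D.
Qed.

(** * Fourier and Chebyshev coefficients *)

(** The integral over a period of [f (cos theta)] times [cis (- (INR n * theta))], without
    normalization. *)
Definition fourier0 (f : C -> C) (n : nat) : C :=
  (RInt (fun theta => fst (lift (- INR n) f (0, theta))) 0 (2 * PI),
   RInt (fun theta => snd (lift (- INR n) f (0, theta))) 0 (2 * PI)).

(** [lift (- INR n) f] differs from the integrand by the factor [exp (- n t)], so the constant mean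
    becomes growth in [exp (n t)]. *)
Lemma fourier_is_RInt (f : C -> C) (L t : R) (n : nat) :
  strip_analytic f L -> 0 <= t < L ->
  is_RInt (V := C_R_NormedModule)
    (fun theta => f (ellipse_point (exp t) theta) * cis (- (INR n * theta)))%C
    0 (2 * PI) (RtoC (exp (INR n * t)) * fourier0 f n)%C.
Proof.
  intros HA Ht.
  destruct (fourier_means_constant f L t n HA Ht) as [E1 E2].
  assert (X : is_RInt (V := C_R_NormedModule) (fun theta => lift (- INR n) f (t, theta))
    0 (2 * PI) (fourier0 f n)).
  { unfold fourier0. rewrite <- E1, <- E2.
    apply (is_RInt_fct_extend_pair (U := R_NormedModule) (V := R_NormedModule)).
    - apply (RInt_correct (fun theta => fst (lift (- INR n) f (t, theta)))).
      apply lift_ex_RInt with L; auto using fst_lipschitz. lra.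
    - apply (RInt_correct (fun theta => snd (lift (- INR n) f (t, theta)))).
      apply lift_ex_RInt with L; auto using snd_lipschitz. lra. }
  replace (RtoC (exp (INR n * t)) * fourier0 f n)%C
    with (scal (V := C_R_ModuleSpace) (exp (INR n * t)) (fourier0 f n)).
  2: { apply injective_projections; unfold scal; simpl; unfold scal; simpl; unfold mult; simpl; ring. }
  apply (is_RInt_ext (V := C_R_NormedModule)
    (fun theta => scal (V := C_R_ModuleSpace) (exp (INR n * t)) (lift (- INR n) f (t, theta)))).
  - intros x _. rewrite ellipse_point_exp. unfold lift.
    transitivity (RtoC (exp (INR n * t)) * (cexp ((- INR n)%R * (t, x)) * f (ccosh (t, x))))%C.
    { apply injective_projections; unfold scal; simpl; unfold scal; simpl; unfold mult; simpl; ring. }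
    (* The [lazymatch] restates the equality at type [C], where [ring] applies. *)
    replace (cis (- (INR n * x))) with (RtoC (exp (INR n * t)) * cexp ((- INR n)%R * (t, x)))%C;
      [lazymatch goal with |- @eq _ ?a ?b => change (@eq C a b) end; ring|].
    unfold cexp, cis; simpl.
    replace (- INR n * x + 0 * t) with (- (INR n * x)) by ring.
    replace (- INR n * t - 0 * x) with (- (INR n * t)) by ring.
    rewrite exp_Ropp.
    pose proof (exp_pos (INR n * t)).
    apply injective_projections; simpl; field; lra.
  - apply (is_RInt_scal (V := C_R_NormedModule) _ _ _ (exp (INR n * t)) _ X).
Qed.

(** The source of the positivity of [M], without which its logarithm would be meaningless: a nonzero
    Fourier coefficient bounds the mean modulus from below. *)
Lemma fourier0_le_abs_mean (f : C -> C) (L t : R) (n : nat) :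
  strip_analytic f L -> 0 <= t < L ->
  exp (INR n * t) * Cmod (fourier0 f n) <= abs_mean f t.
Proof.
  intros HA Ht. pose proof PI2_1.
  pose proof (fourier_is_RInt f L t n HA Ht) as X.
  assert (Y := RInt_correct _ _ _ (abs_ex_RInt f L t HA ltac:(lra))).
  assert (P : forall x, 0 <= x <= 2 * PI ->
    Cmod (f (ellipse_point (exp t) x) * cis (- (INR n * x)))%C <= Cmod (f (ccosh (t, x)))).
  { intros x _. rewrite ellipse_point_exp, Cmod_mult.
    replace (Cmod (cis (- (INR n * x)))) with 1; [lra|].
    replace (cis (- (INR n * x))) with (cexp (0, - (INR n * x))).
    - rewrite Cmod_cexp. simpl. now rewrite exp_0.
    - unfold cexp, cis. simpl. rewrite exp_0. now rewrite !Rmult_1_l. }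
  assert (HPI : 0 <= 2 * PI) by lra.
  assert (Z : norm (V := C_R_NormedModule) (RtoC (exp (INR n * t)) * fourier0 f n)%C
    <= abs_mean f t).
  { apply norm_RInt_le with (1 := HPI) (3 := X) (4 := Y).
    intros x Hx. rewrite <- Cmod_norm. now apply P. }
  rewrite <- Cmod_norm in Z.
  rewrite Cmod_mult, Cmod_R, Rabs_pos_eq in Z by (left; apply exp_pos). exact Z.
Qed.

Section ChebyshevCoefficient.
Context (f : C -> C) (L : R) (n : nat) (HL : 0 < L) (HA : strip_analytic f L).
(** [p] stands for the real or the imaginary part, so that the complex integral is treated
    componentwise. *)
Context (p : C -> R) (Hp : forall z w : C, Rabs (p z - p w) <= Cmod (z - w)%C)
  (p_plus : forall z w : C, p (z + w)%C = p z + p w)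
  (p_scal : forall (z : C) (r : R), p (z * RtoC r)%C = p z * r).

Let u (theta : R) : C := (f (RtoC (cos theta)) * RtoC (cos (INR n * theta)))%C.

Lemma lift_0 (alpha theta : R) :
  lift alpha f (0, theta) = (cis (alpha * theta) * f (RtoC (cos theta)))%C.
Proof.
  unfold lift. f_equal.
  - unfold cexp, cis; simpl. replace (alpha * 0 - 0 * theta) with 0 by ring.
    replace (alpha * theta + 0 * 0) with (alpha * theta) by ring.
    now rewrite exp_0, !Rmult_1_l.
  - f_equal. unfold ccosh, cexp; simpl. rewrite Ropp_0, exp_0, cos_neg, sin_neg.
    apply injective_projections; simpl; field.
Qed.

Lemma integrand_lift (theta : R) :
  p (u theta) = (p (lift (- INR n) f (0, theta)) + p (lift (INR n) f (0, theta))) * / 2.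
Proof.
  rewrite <- p_plus, <- p_scal. f_equal. rewrite !lift_0. unfold u, cis.
  replace (- INR n * theta) with (- (INR n * theta)) by ring.
  rewrite cos_neg, sin_neg.
  apply injective_projections; simpl; field.
Qed.

Lemma lift_reflect (theta : R) :
  lift (INR n) f (0, theta) = lift (- INR n) f (0, 2 * PI - theta).
Proof.
  rewrite !lift_0. unfold cis.
  replace (- INR n * (2 * PI - theta)) with (INR n * theta + - (2 * INR n * PI)) by ring.
  replace (2 * PI - theta) with (- theta + 2 * PI) by ring.
  rewrite <- (cos_period (INR n * theta + - (2 * INR n * PI)) n).
  rewrite <- (sin_period (INR n * theta + - (2 * INR n * PI)) n).
  replace (INR n * theta + - (2 * INR n * PI) + 2 * INR n * PI) with (INR n * theta) by ring.
  rewrite cos_plus, cos_neg, cos_2PI, sin_2PI. do 3 f_equal. ring.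
Qed.

Lemma integrand_continuous (theta : R) :
  -1 <= theta <= 2 * PI + 1 -> continuous (fun x => p (u x)) theta.
Proof.
  intros H. apply continuous_ext with
    (fun theta => (p (lift (- INR n) f (0, theta)) + p (lift (INR n) f (0, theta))) * / 2).
  { intros x. symmetry. apply integrand_lift. }
  apply (continuous_mult (K := R_AbsRing)); [|apply continuous_const].
  apply (continuous_plus (V := R_NormedModule)); apply lift_continuous with L; auto; lra.
Qed.

(** Writing the cosine as a half sum of exponentials, the reflection [theta -> 2 PI - theta] carries
    the term in [+ n] on [[0, PI]] to the term in [- n] on [[PI, 2 PI]]. *)
Lemma half_period_mean :
  RInt (fun x => p (u x)) 0 PI = RInt (fun x => p (lift (- INR n) f (0, x))) 0 (2 * PI) / 2.
Proof.
  pose proof PI2_1 as HPI.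
  set (g := fun x => p (lift (- INR n) f (0, x))).
  assert (X : forall a b, -1 <= a <= 2 * PI + 1 -> -1 <= b <= 2 * PI + 1 -> ex_RInt g a b).
  { intros a b Ha Hb. apply (ex_RInt_continuous (V := R_CompleteNormedModule)).
    intros z Hz. apply lift_continuous with L; auto; [lra|]. revert Hz. unfold Rmin, Rmax.
    destruct (Rle_dec a b); lra. }
  assert (E : is_RInt (fun y => scal (-1) (g (-1 * y + 2 * PI))) 0 PI (RInt g (2 * PI) PI)).
  { apply (is_RInt_comp_lin g (-1) (2 * PI) 0 PI).
    replace (-1 * 0 + 2 * PI) with (2 * PI) by ring. replace (-1 * PI + 2 * PI) with PI by ring.
    apply (RInt_correct g). apply X; lra. }
  pose proof (is_RInt_minus _ _ _ _ _ _ (RInt_correct g 0 PI (X 0 PI ltac:(lra) ltac:(lra))) E) as F.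
  apply (is_RInt_scal _ _ _ (/ 2)) in F.
  apply is_RInt_unique.
  replace (RInt g 0 (2 * PI) / 2) with (scal (/ 2) (minus (RInt g 0 PI) (RInt g (2 * PI) PI))).
  - apply is_RInt_ext with (2 := F). intros x _. rewrite integrand_lift, lift_reflect. fold (g x).
    unfold scal, minus, plus, opp; simpl. unfold mult; simpl. unfold g.
    replace (-1 * x + 2 * PI) with (2 * PI - x) by ring. ring.
  - rewrite <- (RInt_Chasles g 0 PI (2 * PI)) by (apply X; lra).
    rewrite <- (opp_RInt_swap g PI (2 * PI)) by (apply X; lra).
    unfold scal, minus, plus, opp; simpl. unfold mult; simpl. field.
Qed.

(** The substitution [theta = acos x] removes the singularity: the truncated integral runs over
    [[acos b, acos a]] and misses two short intervals on which the integrand is bounded. *)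
Lemma chebyshev_truncated_integral (eps : R) : 0 < eps ->
  exists d, 0 < d /\ forall a b, -1 < a < -1 + d -> 1 - d < b < 1 ->
    exists I, is_RInt (fun x => p (f (RtoC x) * RtoC (chebyshev_T n x / sqrt (1 - x ^ 2)))%C) a b I
      /\ Rabs (I - RInt (fun x => p (u x)) 0 PI) < eps.
Proof.
  intros He. pose proof PI2_1 as HPI.
  (* These two jets are used for their bound on the value at the base point. *)
  destruct (lift_jet2 f L (- INR n) 0 HA ltac:(lra)) as (K1 & d1 & Hd1 & J1).
  destruct (lift_jet2 f L (INR n) 0 HA ltac:(lra)) as (K2 & d2 & Hd2 & J2).
  assert (p0 : p 0%C = 0).
  { replace (RtoC 0) with (0 * RtoC 0)%C by ring. rewrite p_scal. ring. }
  assert (Bu : forall x, 0 <= x <= PI -> Rabs (p (u x)) <= K1 + K2).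
  { intros x Hx. destruct (J1 x ltac:(lra)) as (_ & _ & B1 & _).
    destruct (J2 x ltac:(lra)) as (_ & _ & B2 & _). rewrite Cplus_0_r in B1, B2.
    pose proof (Hp (lift (- INR n) f (0, x)) 0) as P1. pose proof (Hp (lift (INR n) f (0, x)) 0) as P2.
    rewrite p0, Rminus_0_r in P1, P2.
    replace (lift (- INR n) f (0, x) - 0)%C with (lift (- INR n) f (0, x)) in P1 by ring.
    replace (lift (INR n) f (0, x) - 0)%C with (lift (INR n) f (0, x)) in P2 by ring.
    rewrite integrand_lift. split_Rabs; lra. }
  set (M := 1 + (K1 + K2)).
  assert (HM : 1 <= M).
  { pose proof (Bu 0 ltac:(lra)). pose proof (Rabs_pos (p (u 0))). unfold M; lra. }
  (* Each missing end costs at most [M * e], and [4 * M * e <= eps]. *)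
  set (e := Rmin 1 (eps / (4 * M))).
  assert (e0 : 0 < e).
  { apply Rmin_glb_lt; [lra|]. apply Rdiv_lt_0_compat; lra. }
  assert (e1 : e <= 1) by apply Rmin_l.
  assert (e2 : 4 * M * e <= eps).
  { apply Rle_trans with (4 * M * (eps / (4 * M))); [|right; field; lra].
    apply Rmult_le_compat_l; [lra | apply Rmin_r]. }
  (* With [d = 1 - cos e], [b > 1 - d] says [acos b < e], and [a < -1 + d] says
     [acos a > PI - e]. *)
  assert (cos_e : cos e < 1) by (rewrite <- cos_0; apply cos_decreasing_1; lra).
  assert (cos_e0 : 0 < cos e) by (apply cos_gt_0; lra).
  exists (1 - cos e). split; [lra|]. intros a b Ha Hb.
  pose proof (acos_bound_lt a ltac:(lra)) as A0. pose proof (acos_bound_lt b ltac:(lra)) as B0.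
  assert (Bb : acos b < e).
  { apply Rnot_le_lt. intros N. apply cos_decr_1 in N; try lra.
    rewrite cos_acos in N by lra. lra. }
  assert (Aa : PI - e < acos a).
  { apply Rnot_le_lt. intros N. apply cos_decr_1 in N; try lra.
    rewrite cos_acos in N by lra.
    replace (PI - e) with (- e + PI) in N by ring. rewrite neg_cos, cos_neg in N. lra. }
  exists (RInt (fun x => p (u x)) (acos b) (acos a)).
  assert (X : forall x y, 0 <= x <= PI -> 0 <= y <= PI -> ex_RInt (fun x => p (u x)) x y).
  { intros x y Hx Hy. apply (ex_RInt_continuous (V := R_CompleteNormedModule)).
    intros z Hz. apply integrand_continuous. revert Hz. unfold Rmin, Rmax.
    destruct (Rle_dec x y); lra. }
  split.
  - assert (S : forall x, -1 < x < 1 -> 0 < 1 - x²) by (intros; unfold Rsqr; nra).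
    pose proof (is_RInt_comp (V := R_CompleteNormedModule) (fun x => p (u x)) acos
      (fun x => -1 / sqrt (1 - x²)) a b) as Y.
    assert (Z : is_RInt (fun y => scal (-1 / sqrt (1 - y²)) (p (u (acos y)))) a b
      (RInt (fun x => p (u x)) (acos a) (acos b))).
    { assert (W : forall x, Rmin a b <= x <= Rmax a b -> -1 < x < 1).
      { intros x. unfold Rmin, Rmax. destruct (Rle_dec a b); lra. }
      apply Y.
      - intros x Hx. apply W in Hx. pose proof (acos_bound_lt x Hx). apply integrand_continuous; lra.
      - intros x Hx. apply W in Hx. split.
        + apply is_derive_Reals. rewrite <- (derive_pt_acos x Hx).
          apply (derive_pt_eq_1 acos x _ (derivable_pt_acos x Hx)). reflexivity.
        + apply (ex_derive_continuous (fun x => -1 / sqrt (1 - x²))).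
          unfold Rsqr. auto_derive. pose proof (S x Hx) as Sx. unfold Rsqr in Sx.
          split; auto. split; auto. apply Rgt_not_eq. apply sqrt_lt_R0. lra. }
    (* [acos] reverses orientation and has a negative derivative; one factor [-1] corrects both
       sides. *)
    apply (is_RInt_scal _ _ _ (-1)) in Z.
    rewrite <- (opp_RInt_swap (fun x => p (u x)) (acos a) (acos b)) by (apply X; lra).
    replace (opp (RInt (fun x => p (u x)) (acos a) (acos b)))
      with (scal (-1) (RInt (fun x => p (u x)) (acos a) (acos b)))
      by (unfold scal, opp; simpl; unfold mult; simpl; ring).
    apply is_RInt_ext with (2 := Z). intros x.
    unfold Rmin, Rmax. destruct (Rle_dec a b); intros Hx;
    (unfold u; rewrite !p_scal, cos_acos by lra; unfold chebyshev_T;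
     unfold scal; simpl; unfold mult; simpl;
     replace (1 - x * (x * 1)) with (1 - x²) by (unfold Rsqr; ring);
     pose proof (sqrt_lt_R0 _ (S x ltac:(lra))); field; lra).
  - rewrite <- (RInt_Chasles (fun x => p (u x)) 0 (acos b) PI) by (apply X; lra).
    rewrite <- (RInt_Chasles (fun x => p (u x)) (acos b) (acos a) PI) by (apply X; lra).
    pose proof (abs_RInt_le_const (fun x => p (u x)) 0 (acos b) M ltac:(lra)
      (X 0 (acos b) ltac:(lra) ltac:(lra))
      ltac:(intros t Ht; pose proof (Bu t ltac:(lra)); unfold M; lra)) as I1.
    pose proof (abs_RInt_le_const (fun x => p (u x)) (acos a) PI M ltac:(lra)
      (X (acos a) PI ltac:(lra) ltac:(lra))
      ltac:(intros t Ht; pose proof (Bu t ltac:(lra)); unfold M; lra)) as I2.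
    unfold plus; simpl.
    assert ((acos b - 0) * M <= M * e) by nra.
    assert ((PI - acos a) * M <= M * e) by nra.
    assert (0 < M * e) by nra.
    split_Rabs; lra.
Qed.
End ChebyshevCoefficient.

(** This transfers [a_n <> 0] to the Fourier integral. It also shows that the improper integral
    converges, so that [RInt_gen] has its intended value. *)
Lemma cheb1_coeff_fourier0 (f : C -> C) (L : R) (n : nat) :
  0 < L -> strip_analytic f L ->
  cheb1_coeff f n = (RtoC (2 / PI) * (RtoC (/ 2) * fourier0 f n))%C.
Proof.
  intros HL HA. unfold cheb1_coeff. f_equal.
  apply is_RInt_gen_unique.
  assert (H1 := half_period_mean f L n HL HA fst fst_lipschitz (fun _ _ => eq_refl)
    ltac:(intros; simpl; ring)).
  assert (H2 := half_period_mean f L n HL HA snd snd_lipschitz (fun _ _ => eq_refl)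
    ltac:(intros; simpl; ring)).
  unfold fourier0.
  set (A := RInt _ 0 (2 * PI)) in *.
  set (B := RInt (fun theta => snd _) 0 (2 * PI)) in *.
  clearbody A B.
  replace (RtoC (/ 2) * (A, B))%C with ((A / 2, B / 2) : C)
    by (apply injective_projections; simpl; field).
  intros P [e He].
  destruct (chebyshev_truncated_integral f L n HL HA fst fst_lipschitz (fun _ _ => eq_refl)
    ltac:(intros; simpl; ring) e (cond_pos e)) as (d1 & Hd1 & X1).
  destruct (chebyshev_truncated_integral f L n HL HA snd snd_lipschitz (fun _ _ => eq_refl)
    ltac:(intros; simpl; ring) e (cond_pos e)) as (d2 & Hd2 & X2).
  set (d := Rmin d1 d2).
  assert (Hd : 0 < d) by (now apply Rmin_glb_lt).
  assert (d1' : d <= d1) by apply Rmin_l. assert (d2' : d <= d2) by apply Rmin_r.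
  apply Filter_prod with (Q := fun a => -1 < a < -1 + d) (R := fun b => 1 - d < b < 1).
  - exists (mkposreal d Hd). intros x Hx Hlt.
    unfold ball in Hx; simpl in Hx. unfold AbsRing_ball, abs, minus, plus, opp in Hx; simpl in Hx.
    split_Rabs; lra.
  - exists (mkposreal d Hd). intros x Hx Hlt.
    unfold ball in Hx; simpl in Hx. unfold AbsRing_ball, abs, minus, plus, opp in Hx; simpl in Hx.
    split_Rabs; lra.
  - intros a b Ha Hb. simpl.
    destruct (X1 a b ltac:(lra) ltac:(lra)) as (I1 & HI1 & E1).
    destruct (X2 a b ltac:(lra) ltac:(lra)) as (I2 & HI2 & E2).
    exists (I1, I2). split.
    + apply (is_RInt_fct_extend_pair (U := R_NormedModule) (V := R_NormedModule)); assumption.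
    + apply He. rewrite H1 in E1. rewrite H2 in E2.
      split; unfold ball; simpl; unfold AbsRing_ball, abs, minus, plus, opp; simpl.
      * eapply Rle_lt_trans; [|exact E1]. right. reflexivity.
      * eapply Rle_lt_trans; [|exact E2]. right. reflexivity.
Qed.

(** * Convexity *)

Definition convex_on (L : R) (phi : R -> R) : Prop :=
  forall x y z, 0 <= x -> x < y -> y < z -> z < L ->
    (phi y - phi x) / (y - x) <= (phi z - phi y) / (z - y).

(** With [al] the opposite of the chord slope over [[x, z]], the weighted mean takes equal values at
    [x] and [z]; the maximum principle at [y] puts [phi] below the chord. *)
Lemma log_abs_mean_convex (f : C -> C) (L : R) :
  strip_analytic f L -> (forall t, 0 <= t < L -> 0 < abs_mean f t) ->
  convex_on L (fun t => ln (abs_mean f t)).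
Proof.
  intros HA Hm x y z Hx Hxy Hyz Hz. cbv beta.
  set (phi := fun t => ln (abs_mean f t)).
  fold (phi x) (phi y) (phi z).
  set (al := - (phi z - phi x) / (z - x)).
  assert (E : forall t, 0 <= t < L -> exp (al * t) * abs_mean f t = exp (al * t + phi t)).
  { intros t Ht. rewrite exp_plus. unfold phi. now rewrite exp_ln by now apply Hm. }
  assert (Ez : al * z + phi z = al * x + phi x) by (unfold al; field; lra).
  pose proof (abs_mean_three_lines f L al x z (exp (al * x + phi x)) HA ltac:(lra) ltac:(lra) Hz
    ltac:(rewrite E by lra; lra) ltac:(rewrite E, Ez by lra; lra) y ltac:(lra)) as H.
  rewrite E in H by lra.
  assert (Q : al * y + phi y <= al * x + phi x).
  { apply Rnot_lt_le. intros N. apply exp_increasing in N. lra. }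
  apply Rle_trans with (- al).
  - apply Rmult_le_reg_r with (y - x); [lra|].
    unfold Rdiv. rewrite Rmult_assoc, Rinv_l by lra. lra.
  - apply Rmult_le_reg_r with (z - y); [lra|].
    unfold Rdiv. rewrite Rmult_assoc, Rinv_l by lra. lra.
Qed.

(** * Difference quotients and slopes of [M] *)

(** [0 + / (INR k + 1)] is what [Rbar_loc_seq 0 k] reduces to. *)
Lemma eventually_inv_small (d : R) : 0 < d ->
  eventually (fun k => 0 < 0 + / (INR k + 1) < d).
Proof.
  intros Hd. destruct (archimed_cor1 d Hd) as (N & HN & HN0).
  exists N. intros k Hk. apply le_INR in Hk. apply lt_0_INR in HN0.
  rewrite Rplus_0_l. split; [apply Rinv_0_lt_compat; lra|].
  apply Rlt_trans with (2 := HN). apply Rinv_lt_contravar; nra.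
Qed.

Lemma is_lim_seq_difference_quotient (g : R -> R) (x l : R) : is_derive g x l ->
  is_lim_seq (fun k => (g (x + Rbar_loc_seq 0 k) - g x) / Rbar_loc_seq 0 k) l.
Proof.
  intros H. apply is_derive_Reals in H. apply is_lim_seq_spec. intros e.
  destruct (H e (cond_pos e)) as [d Hd].
  generalize (eventually_inv_small d (cond_pos d)). apply filter_imp.
  intros k Hk. simpl Rbar_loc_seq. apply Hd; [lra|]. rewrite Rabs_pos_eq; lra.
Qed.

(** [Derive] is by definition the limit of the difference quotients along
    [1 / (k + 1)], so it is a right derivative and convexity alone controls it,
    without any differentiability of [M]. *)
Lemma Derive_exp_convex_ln (M phi : R -> R) (K L s t w : R) :
  0 < K -> convex_on L phi ->
  (forall x, 0 <= x < L -> M (exp x) = K * exp (phi x)) ->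
  0 <= s -> s < t -> t < w -> w < L ->
  (phi t - phi s) / (t - s) <= exp t * Derive M (exp t) / M (exp t) <= (phi w - phi t) / (w - t).
Proof.
  intros HK Hc HM Hs Hst Htw Hw.
  set (rho := exp t).
  assert (Hr : 0 < rho) by apply exp_pos.
  assert (Mp : 0 < M rho).
  { unfold rho. rewrite HM by lra. pose proof (exp_pos (phi t)). nra. }
  (* [G sigma u = M rho * (u / rho) ^ sigma] is the line of slope [sigma] through the graph point at
     [rho] in logarithmic coordinates. To the right of [rho], convexity squeezes [M] between two
     such curves. *)
  set (G := fun sigma u => M rho * exp (sigma * (ln u - t))).
  assert (G0 : forall sigma, G sigma rho = M rho).
  { intros sigma. unfold G, rho. rewrite ln_exp, Rminus_diag, Rmult_0_r, exp_0. ring. }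
  assert (DG : forall sigma, is_derive (G sigma) rho (M rho * sigma / rho)).
  { intros sigma. unfold G. auto_derive; auto.
    replace (ln rho) with t by (unfold rho; now rewrite ln_exp).
    rewrite Rplus_opp_r, Rmult_0_r, exp_0. field. lra. }
  set (s1 := (phi t - phi s) / (t - s)). set (s2 := (phi w - phi t) / (w - t)).
  assert (B : forall h, 0 < h < exp w - rho ->
    G s1 (rho + h) <= M (rho + h) <= G s2 (rho + h)).
  { intros h Hh. set (v := ln (rho + h)).
    assert (Ev : rho + h = exp v) by (unfold v; rewrite exp_ln; lra).
    assert (tv : t < v) by (apply exp_lt_inv; rewrite <- Ev; fold rho; lra).
    assert (vw : v < w) by (apply exp_lt_inv; rewrite <- Ev; lra).
    unfold G. fold v. rewrite Ev, (HM v) by lra. unfold rho. rewrite (HM t) by lra.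
    pose proof (Hc s t v Hs Hst tv ltac:(lra)) as C1. fold s1 in C1.
    pose proof (Hc t v w ltac:(lra) tv vw Hw) as C2.
    (* The chord slope over [[t, w]] is a weighted mean of those over [[t, v]] and [[v, w]], of
       which the first is the smaller. *)
    assert (C3 : (phi v - phi t) / (v - t) <= s2).
    { unfold s2. apply Rmult_le_reg_r with (w - t); [lra|].
      unfold Rdiv at 2. rewrite Rmult_assoc, Rinv_l, Rmult_1_r by lra.
      apply Rmult_le_compat_r with (r := w - v) in C2; [|lra].
      unfold Rdiv at 2 in C2. rewrite Rmult_assoc, Rinv_l, Rmult_1_r in C2 by lra.
      assert ((phi v - phi t) / (v - t) * (v - t) = phi v - phi t) by (field; lra). lra. }
    assert (X : (phi v - phi t) / (v - t) * (v - t) = phi v - phi t) by (field; lra).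
    rewrite !Rmult_assoc, <- !exp_plus.
    assert (mono : forall a b, a <= b -> K * exp a <= K * exp b).
    { intros a b [Hab|Hab].
      - apply exp_increasing in Hab. nra.
      - rewrite Hab; lra. }
    split; apply mono; nra. }
  set (Q := fun (g : R -> R) k => (g (rho + Rbar_loc_seq 0 k) - g rho) / Rbar_loc_seq 0 k).
  assert (L1 : Rbar_le (M rho * s1 / rho) (Lim_seq (Q M))).
  { rewrite <- (is_lim_seq_unique _ _ (is_lim_seq_difference_quotient _ _ _ (DG s1))).
    apply Lim_seq_le_loc.
    generalize (eventually_inv_small (exp w - rho) ltac:(unfold rho; pose proof (exp_increasing t w Htw); lra)).
    apply filter_imp. intros k Hk. unfold Q. simpl Rbar_loc_seq. rewrite G0.
    apply Rmult_le_compat_r; [left; apply Rinv_0_lt_compat; lra|].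
    pose proof (B _ Hk). lra. }
  assert (L2 : Rbar_le (Lim_seq (Q M)) (M rho * s2 / rho)).
  { rewrite <- (is_lim_seq_unique _ _ (is_lim_seq_difference_quotient _ _ _ (DG s2))).
    apply Lim_seq_le_loc.
    generalize (eventually_inv_small (exp w - rho) ltac:(unfold rho; pose proof (exp_increasing t w Htw); lra)).
    apply filter_imp. intros k Hk. unfold Q. simpl Rbar_loc_seq. rewrite G0.
    apply Rmult_le_compat_r; [left; apply Rinv_0_lt_compat; lra|].
    pose proof (B _ Hk). lra. }
  change (Derive M rho) with (real (Lim_seq (Q M))).
  (* Lying between finite bounds, the limit is finite, so [real] does not return its default
     value. *)
  destruct (Lim_seq (Q M)) as [l| |]; simpl in L1, L2; try contradiction. simpl real.
  assert (E : forall sg, sg = rho * (M rho * sg / rho) / M rho) by (intros; field; lra).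
  assert (P : 0 < rho / M rho) by (apply Rdiv_lt_0_compat; lra).
  rewrite (E s1), (E s2). unfold Rdiv in *.
  split; apply Rmult_le_compat_r; try (apply Rmult_le_compat_l; lra);
    left; apply Rinv_0_lt_compat; lra.
Qed.

(** * The condition number in the variable [t] *)

Lemma mean_M_exp (f : C -> C) (t : R) : mean_M f (exp t) = / PI * abs_mean f t.
Proof.
  unfold mean_M, abs_mean, Rdiv. rewrite Rmult_1_l. f_equal.
  apply RInt_ext. intros x _. now rewrite ellipse_point_exp.
Qed.

Lemma kappa_Ch1_exp (f : C -> C) (L t : R) (n : nat) :
  strip_analytic f L -> 0 <= t < L ->
  kappa_Ch1 f n (exp t) = abs_mean f t / (exp (INR n * t) * Cmod (fourier0 f n)).
Proof.
  intros HA Ht. unfold kappa_Ch1. f_equal.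
  - apply RInt_ext. intros x _. now rewrite ellipse_point_exp.
  - f_equal. rewrite (is_RInt_unique (V := C_R_CompleteNormedModule) _ _ _ _
      (fourier_is_RInt f L t n HA Ht)).
    rewrite Cmod_mult, Cmod_R, Rabs_pos_eq; auto. left; apply exp_pos.
Qed.

Theorem theorem3p7 (rho_max : R) (f : C -> C) (n : nat)
  (h_rho_max : 1 < rho_max)
  (h_analytic : forall rho : R, 1 <= rho < rho_max ->
     forall z : C, inside_or_on_ellipse rho z -> analytic_at f z)
  (h_coeff : cheb1_coeff f n <> RtoC 0) :
  (Rbar_lt (vartheta f rho_max) (Finite (INR n)) ->
     strictly_decreasing_on (kappa_Ch1 f n) 1 rho_max)
  /\
  (vartheta f rho_max = p_infty ->
     exists rho0 : R, 1 <= rho0 < rho_max /\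
       strictly_increasing_on (kappa_Ch1 f n) rho0 rho_max)
  /\
  (Rbar_lt (vartheta f rho_max) p_infty ->
   (exists L : R, filterlim (mean_M f) (at_left rho_max) (locally L)) ->
   Rbar_lt (vartheta f rho_max) (Finite (INR n)) ->
     is_the_minimizer (extend_by_left_limit (kappa_Ch1 f n) rho_max)
       1 rho_max rho_max).
Proof.
  pose proof (analytic_strip f rho_max h_rho_max h_analytic) as HA.
  set (L := ln rho_max) in *.
  assert (HL : 0 < L) by (rewrite <- ln_1; apply ln_increasing; lra).
  assert (Hc : 0 < Cmod (fourier0 f n)).
  { apply Cmod_gt_0. intros E. apply h_coeff.
    rewrite (cheb1_coeff_fourier0 f L n HL HA), E. ring. }
  set (phi := fun t => ln (abs_mean f t)).
  assert (Hm : forall t, 0 <= t < L -> 0 < abs_mean f t).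
  { intros t Ht. apply Rlt_le_trans with (2 := fourier0_le_abs_mean f L t n HA Ht).
    apply Rmult_lt_0_compat; auto. apply exp_pos. }
  pose proof (log_abs_mean_convex f L HA Hm) as Hconv. fold phi in Hconv.
  assert (HM : forall t, 0 <= t < L -> mean_M f (exp t) = / PI * exp (phi t)).
  { intros t Ht. rewrite mean_M_exp. unfold phi. now rewrite exp_ln by now apply Hm. }
  assert (Hk : forall t, 0 <= t < L ->
    kappa_Ch1 f n (exp t) = exp (phi t - INR n * t) / Cmod (fourier0 f n)).
  { intros t Ht. rewrite (kappa_Ch1_exp f L) by auto.
    unfold Rminus. rewrite exp_plus, exp_Ropp. unfold phi. rewrite exp_ln by now apply Hm.
    pose proof (exp_pos (INR n * t)). field. lra. }
  assert (PI0 : 0 < / PI) by (apply Rinv_0_lt_compat, PI_RGT_0).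
  assert (Hlog : forall x, 1 <= x < rho_max -> 0 <= ln x < L /\ x = exp (ln x)).
  { intros x Hx. rewrite exp_ln by lra. repeat split.
    - destruct (proj1 Hx) as [H|<-]; [|rewrite ln_1; lra].
      left. rewrite <- ln_1. apply ln_increasing; lra.
    - apply ln_increasing; lra. }
  assert (kappa_lt : forall x y, 1 <= x < rho_max -> 1 <= y < rho_max ->
    phi (ln x) - INR n * ln x < phi (ln y) - INR n * ln y ->
    kappa_Ch1 f n x < kappa_Ch1 f n y).
  { intros x y Hx Hy H.
    destruct (Hlog x Hx) as [Lx Ex]. destruct (Hlog y Hy) as [Ly Ey].
    rewrite Ex, Ey, (Hk (ln x)), (Hk (ln y)) by auto.
    apply Rmult_lt_compat_r; [now apply Rinv_0_lt_compat|]. now apply exp_increasing. }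
  destruct (Lub_Rbar_correct (fun y => exists rho, 1 < rho < rho_max /\
    y = rho * Derive (mean_M f) rho / mean_M f rho)) as [Hub Hlub].
  fold (vartheta f rho_max) in Hub, Hlub.
  (* The left endpoint 1 is included because the minimization runs over the closed interval. *)
  assert (Decr : Rbar_lt (vartheta f rho_max) (INR n) ->
    forall x y, 1 <= x -> x < y -> y < rho_max -> kappa_Ch1 f n y < kappa_Ch1 f n x).
  { intros Hn x y Hx Hxy Hy. apply kappa_lt; try lra.
    destruct (Hlog x ltac:(lra)) as [Lx Ex]. destruct (Hlog y ltac:(lra)) as [Ly Ey].
    pose proof (ln_increasing x y ltac:(lra) Hxy) as Lxy.
    (* The chord from [ln x] to [ln y] has slope at most the logarithmic derivative at [y], hence
       below [n]. The last point is an arbitrary one between [ln y] and [L]. *)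
    destruct (Derive_exp_convex_ln (mean_M f) phi (/ PI) L (ln x) (ln y) ((ln y + L) / 2))
      as [D _]; auto; try lra.
    rewrite <- Ey in D.
    assert (U : y * Derive (mean_M f) y / mean_M f y < INR n).
    { apply (Rbar_le_lt_trans (y * Derive (mean_M f) y / mean_M f y) (vartheta f rho_max) (INR n)); auto.
      apply Hub. exists y. split; auto. lra. }
    assert (V : (phi (ln y) - phi (ln x)) / (ln y - ln x) * (ln y - ln x) = phi (ln y) - phi (ln x))
      by (field; lra).
    nra. }
  split; [|split].
  - intros Hn x y Hx Hxy Hy. apply Decr; auto; lra.
  - intros Hinf.
    (* One radius with slope above [n] is enough: beyond it convexity keeps all chord slopes above
       [n]. *)
    assert (W : exists rho, 1 < rho < rho_max /\ INR n < rho * Derive (mean_M f) rho / mean_M f rho).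
    { apply NNPP. intros N.
      assert (U : Rbar_le (vartheta f rho_max) (INR n)).
      { apply Hlub. intros y (rho & Hrho & ->). simpl. apply Rnot_lt_le. intros Y.
        apply N. now exists rho. }
      rewrite Hinf in U. exact U. }
    destruct W as (rho & Hrho & Hn). exists rho. split; [lra|].
    intros x y Hx Hxy Hy. apply kappa_lt; try lra.
    destruct (Hlog rho ltac:(lra)) as [Lr Er].
    destruct (Hlog x ltac:(lra)) as [Lx Ex]. destruct (Hlog y ltac:(lra)) as [Ly Ey].
    pose proof (ln_increasing x y ltac:(lra) Hxy) as Lxy.
    pose proof (ln_increasing rho x ltac:(lra) Hx) as Lrx.
    pose proof (ln_increasing 1 rho ltac:(lra) ltac:(lra)) as L1r. rewrite ln_1 in L1r.
    destruct (Derive_exp_convex_ln (mean_M f) phi (/ PI) L 0 (ln rho) (ln x))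
      as [_ D]; auto; try lra.
    rewrite <- Er in D.
    pose proof (Hconv (ln rho) (ln x) (ln y) ltac:(lra) Lrx Lxy ltac:(lra)) as Cv.
    assert (V : (phi (ln y) - phi (ln x)) / (ln y - ln x) * (ln y - ln x) = phi (ln y) - phi (ln x))
      by (field; lra).
    nra.
  - intros _ [l Hl] Hn. split; [lra|]. intros x Hx Hneq.
    unfold extend_by_left_limit.
    destruct (Rlt_dec rho_max rho_max) as [F|_]; [lra|].
    destruct (Rlt_dec x rho_max) as [Hxr|F]; [|lra].
    (* The quotient of [kappa] by [M], continuous at [rho_max]: the limit of [M] therefore yields
       that of [kappa]. *)
    set (c := fun rho => PI / (exp (INR n * ln rho) * Cmod (fourier0 f n))).
    assert (Near : at_left rho_max (fun rho => 1 < rho < rho_max)).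
    { exists (mkposreal (rho_max - 1) ltac:(lra)). intros y Hy Hlt.
      unfold ball in Hy; simpl in Hy. unfold AbsRing_ball, abs, minus, plus, opp in Hy; simpl in Hy.
      split_Rabs; lra. }
    assert (Hlim : filterlim (kappa_Ch1 f n) (at_left rho_max) (locally (l * c rho_max))).
    { apply filterlim_ext_loc with (fun rho => mult (mean_M f rho) (c rho)).
      - generalize Near. apply filter_imp. intros rho Hrho.
        destruct (Hlog rho ltac:(lra)) as [Lr Er].
        rewrite Er at 1 3. rewrite mean_M_exp, (kappa_Ch1_exp f L) by auto.
        unfold c, mult; simpl. pose proof (exp_pos (INR n * ln rho)). pose proof PI_RGT_0.
        field. repeat split; lra.
      - apply (filterlim_comp_2 (mean_M f) c mult Hl (H := locally (c rho_max))).
        + apply (filterlim_filter_le_1 (F := locally rho_max)); [exact (filter_le_within _)|].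
          apply (ex_derive_continuous c). unfold c. auto_derive.
          pose proof (exp_pos (INR n * ln rho_max)). split; [lra|]. split; auto.
          apply Rgt_not_eq. nra.
        + apply (filterlim_mult (K := R_AbsRing)). }
    assert (E : left_limit (kappa_Ch1 f n) rho_max = l * c rho_max)
      by exact (iota_filterlim_locally (V := R_CompleteNormedModule) _ _ Hlim).
    rewrite E.
    (* Passing to the limit gives only a weak inequality; the intermediate point [y] restores the
       strict one. *)
    set (y := (x + rho_max) / 2).
    apply Rle_lt_trans with (kappa_Ch1 f n y); [|apply Decr; auto; unfold y; lra].
    apply (filterlim_le (F := at_left rho_max) (kappa_Ch1 f n) (fun _ => kappa_Ch1 f n y)
      (l * c rho_max) (kappa_Ch1 f n y)); auto.
    + exists (mkposreal (rho_max - y) ltac:(unfold y; lra)). intros z Hz Hlt.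
      unfold ball in Hz; simpl in Hz. unfold AbsRing_ball, abs, minus, plus, opp in Hz; simpl in Hz.
      left. apply Decr; auto; unfold y in *; split_Rabs; lra.
    + apply filterlim_const.
Qed.
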